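(* Let $d\ge 2$ be an integer and $1\le\alpha\le\infty$. Then $$C(\mathcal{P}_n,B^d_\alpha)\approx n^\sigma\quad\text{and}\quad \sup_{\phi\in\mathcal{P}_n,\ \phi\neq 0}\frac{\|\phi\|_{L_\infty(B^d_\alpha)}}{\|\phi\|_{L_2(B^d_\alpha)}}\approx n^{\sigma/2},\qquad n\ge 1,$$ where $$\sigma=\begin{cases}2+\frac{2}{\alpha}(d-1), & \text{if } 1\le\alpha\le 2,\\ d+1, & \text{if } 2\le\alpha<\infty,\\ 2d, & \text{if }\alpha=\infty.\end{cases}$$
   Context: $\mathcal{P}_n=\mathcal{P}_{n,d}$ is the space of real algebraic polynomials in $d$ variables of total degree $\le n$. For a compact set $D\subset\mathbb{R}^d$ of positive Lebesgue measure and $x\in\mathbb{R}^d$, $C(\mathcal{P}_n,D,x)=\sum_{k=1}^N\phi_k(x)^2$, where $\{\phi_k\}_{k=1}^N$ is any basis of $\mathcal{P}_n$ that is orthonormal in $L_2(D)$ with respect to Lebesgue measure (the value does not depend on the choice of the orthonormal basis); $C(\mathcal{P}_n,D)=\sup_{x\in D}C(\mathcal{P}_n,D,x)$. The unit balls are $B^d_\alpha=\{x\in\mathbb{R}^d:(|x_1|^\alpha+\dots+|x_d|^\alpha)^{1/\alpha}\le 1\}$ for $1\le\alpha<\infty$ and $B^d_\infty=[-1,1]^d$. The notation $\varphi(n)\approx\psi(n)$ means $c^{-1}\psi(n)\le\varphi(n)\le c\,\psi(n)$ with some constant $c>0$ independent of $n$. Norms are with respect to Lebesgue measure. *)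

(* Defs.v *)
From HB Require Import structures.
(* mpoly has to be imported before mathcomp-analysis: in the other order their
   notations clash. *)
From mathcomp.multinomials Require Import mpoly.
From mathcomp Require Import all_boot all_order all_algebra.
From mathcomp Require Import all_classical all_reals all_analysis.

Set Implicit Arguments.
Unset Strict Implicit.
Unset Printing Implicit Defensive.
Import Order.TTheory GRing.Theory Num.Theory.
Import numFieldNormedType.Exports.

Local Open Scope classical_set_scope.
Local Open Scope ring_scope.

(* Points of R^d are d.-tuple R, with the product Borel sigma-algebra of
   mathcomp-analysis; Lebesgue measure on R^(d+1) is the image of the product
   measure on R * R^d under (x, t) |-> x :: t. *)
Section lebesgue_cons.
Local Open Scope ereal_scope.
Context {R : realType} {d : nat}.

Definition cons_pair (p : measurableTypeR R * d.-tuple R) : d.+1.-tuple R :=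
  [tuple of p.1 :: p.2].

Lemma measurable_cons_pair : measurable_fun [set: _] cons_pair.
Proof. exact: (measurable_cons measurable_fst measurable_snd). Qed.

Variable mu : {sigma_finite_measure set (d.-tuple R) -> \bar R}.

Definition lebesgue_cons : set (d.+1.-tuple R) -> \bar R :=
  pushforward (@lebesgue_measure R \x mu) cons_pair.

HB.instance Definition _ := Measure.copy lebesgue_cons
  (measure_function_pushforward__canonical__measure_function_Measure
     _ measurable_cons_pair).

Lemma lebesgue_cons_sigma_finite : sigma_finite setT lebesgue_cons.
Proof.
have /sigma_finiteP[A [UA ndA mA]] := sigma_finiteT (@lebesgue_measure R).
have /sigma_finiteP[F [UF ndF mF]] := sigma_finiteT mu.
exists (fun k => [set t : d.+1.-tuple R |
    A k (thead t) /\ F k [tuple of behead t]]).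
  rewrite eqEsubset; split=> // t _.
  have [i _ Ai] : (\bigcup_i A i) (thead t) by rewrite -UA.
  have [j _ Fj] : (\bigcup_i F i) [tuple of behead t] by rewrite -UF.
  exists (maxn i j) => //; split.
    by have := ndA _ _ (leq_maxl i j); rewrite subsetEset; apply.
  by have := ndF _ _ (leq_maxr i j); rewrite subsetEset; apply.
move=> k; have [mAk Ak] := mA k; have [mFk Fk] := mF k; split.
  apply: measurableI.
    by rewrite -[X in measurable X]setTI; exact: (measurable_tnth ord0).
  by rewrite -[X in measurable X]setTI; exact: measurable_behead.
rewrite /lebesgue_cons /pushforward
  (_ : _ @^-1` _ = A k `*` F k).
  by rewrite product_measure1E// lte_mul_pinfty// ge0_fin_numE.
have beheadK (p : measurableTypeR R * d.-tuple R) :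
  [tuple of behead (cons_pair p)] = p.2 by exact: val_inj.
by rewrite eqEsubset; split=> p /=; rewrite beheadK.
Qed.

HB.instance Definition _ :=
  @Measure_isSigmaFinite.Build _ _ _ lebesgue_cons lebesgue_cons_sigma_finite.

End lebesgue_cons.

Fixpoint lebesgue_tuple (R : realType) (d : nat) :
    {sigma_finite_measure set (d.-tuple R) -> \bar R} :=
  match d with
  | 0 => @dirac _ (0.-tuple R) [tuple] R
  | d'.+1 => lebesgue_cons (lebesgue_tuple R d')
  end.

(* This characterizes Lebesgue measure on Borel sets of R^d. *)
Lemma lebesgue_tuple_box (R : realType) (d : nat) (A : 'I_d -> set R) :
  (forall i, measurable (A i)) ->
  lebesgue_tuple R d [set x | forall i, A i (tnth x i)] =
  (\prod_(i < d) @lebesgue_measure R (A i))%E.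
Proof.
elim: d A => [|d IH] A mA.
  by rewrite big_ord0 /= diracE mem_set//; case.
rewrite big_ord_recl -IH//= /lebesgue_cons /pushforward.
set B := [set x : d.-tuple R | _].
have mB : measurable B.
  rewrite (_ : B = \bigcap_(i : 'I_d) ((@tnth _ R ^~ i) @^-1` A (lift ord0 i))).
    apply: fin_bigcap_measurable => // i _.
    by rewrite -[X in measurable X]setTI; exact: measurable_tnth.
  rewrite eqEsubset; split=> x Bx; first by move=> i _; exact: Bx.
  by move=> i; exact: (Bx i).
rewrite (_ : _ @^-1` _ = A ord0 `*` B).
  by rewrite product_measure1E//; exact: mA.
rewrite eqEsubset; split=> -[a t] /=.
  move=> At; split; first exact: (At ord0).
  by move=> i /=; have /= := At (lift ord0 i); rewrite /cons_pair tnthS.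
case=> /= Aa Bt i; have [j ->|->//] := unliftP ord0 i.
by rewrite /cons_pair tnthS; exact: Bt.
Qed.

Section christoffel.
Context {R : realType} {d : nat}.
Implicit Types (D : set (d.-tuple R)) (p q : {mpoly R[d]}).

(* msize is the total degree plus one, and 0 for the zero polynomial. *)
Definition poly_space (n : nat) : set {mpoly R[d]} :=
  [set p | (msize p <= n.+1)%N].

Definition peval p (x : d.-tuple R) : R := p.@[tnth x].

Definition dotL2 D p q : R :=
  \int[lebesgue_tuple R d]_(x in D) (peval p x * peval q x).

Definition normLp D (r : \bar R) p : \bar R :=
  'N[lebesgue_tuple R d]_r[(fun x => (peval p x)%:E) \_ D].

Definition is_basis (V : set {mpoly R[d]}) (N : nat)
    (phi : 'I_N -> {mpoly R[d]}) :=
  (forall k, V (phi k)) /\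
  (forall p, V p -> exists! c : 'I_N -> R, p = \sum_(k < N) c k *: phi k).

Definition is_orthonormal D (N : nat) (phi : 'I_N -> {mpoly R[d]}) :=
  forall i j, dotL2 D (phi i) (phi j) = (i == j)%:R.

(* All orthonormal bases give the same value when D is compact of positive
   measure; xget selects it (its default value 0 is only taken when there is no
   orthonormal basis at all). *)
Definition christoffel (n : nat) D (x : d.-tuple R) : R :=
  xget 0 [set c : R | exists (N : nat) (phi : 'I_N -> {mpoly R[d]}),
    [/\ is_basis (poly_space n) phi, is_orthonormal D phi &
        c = \sum_(k < N) peval (phi k) x ^+ 2]].

Definition christoffel_sup (n : nat) D : \bar R :=
  ereal_sup [set (christoffel n D x)%:E | x in D].

Definition nikolskii_sup (n : nat) D : \bar R :=
  ereal_sup [set (normLp D +oo p / normLp D 2%:E p)%E |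
    p in [set p | poly_space n p /\ p != 0]].

End christoffel.

Definition lp_ball (R : realType) (d : nat) (alpha : \bar R) :
    set (d.-tuple R) :=
  match alpha with
  | a%:E => [set x | (\sum_(i < d) `|tnth x i| `^ a) `^ a^-1 <= 1]
  | +oo%E => [set x | forall i, tnth x i \in `[-1, 1]]
  | -oo%E => set0
  end.
Arguments lp_ball {R} d alpha.

Definition sigma_exponent (R : realType) (d : nat) (alpha : \bar R) : R :=
  match alpha with
  | a%:E => if a <= 2 then 2 + 2 / a * (d%:R - 1) else d%:R + 1
  | +oo%E => 2 * d%:R
  | -oo%E => 0
  end.

Definition asymp_equiv (R : realType) (f g : nat -> \bar R) :=
  exists2 c : R, 0 < c & forall n, (1 <= n)%N ->
    ((c^-1)%R%:E * g n <= f n <= c%:E * g n)%E.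

(* Main.v *)
From mathcomp.multinomials Require Import mpoly.
Require Import Defs.
From HB Require Import structures.
From mathcomp Require Import all_boot all_order all_algebra.
From mathcomp Require Import all_classical all_reals all_analysis.
From mathcomp Require Import measurable_realfun ess_sup_inf ring lra.

(** Write B for the ball, d for the dimension and gamma for 1/min(alpha, 2), with
    gamma = 1 for the cube. Then sigma = 2 + 2 gamma (d - 1), and n^-sigma is the
    volume of a cell of height n^-2 and of width n^(-2 gamma) in the d - 1 other
    directions. Such a cell is what a polynomial of degree n can resolve of B at
    the boundary points where B is narrowest: n^-2 is the resolution at an
    endpoint of an interval, and t^gamma is the width of B at depth t = n^-2 below
    those points.

    Both quantities express the extremal problem of bounding p(x)^2 by K times the
    integral of p^2 over B, for p of degree at most n and x in B. For fixed x the
    best K is the Christoffel function at x: test the reproducing kernel, or expand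
    p in an orthonormal basis ([christoffel_le], [christoffel_ge]). The Nikolskii
    constant is the square root of its maximum, up to a constant factor: the
    essential supremum of p is compared to values of p by applying the upper bound
    to p^2. So [asymp_of_bounds] asks for the bound K <= C n^sigma at all points, and
    for one polynomial attaining the order n^sigma at one point.

    Upper bound. Each x in B is the tip of a cusp contained in B, with depth
    proportional to t and width proportional to t^gamma ([lp_ball_cusps]). At
    depths above n^-2 this cusp contains a parabolic one, of width b sqrt t with b
    of order n^(1 - 2 gamma). The parabolic cusp is foliated by parabolas through
    x, and on each of them p is a univariate polynomial Q of degree 2n in the
    parameter sqrt t. The inequality Q(0)^2 <= C n (int Q^2) on [-1, 1] follows by
    expanding Q(cos t) sin t in sines; it survives the removal of an interval of
    length c/n around 0, hence the insertion of a weight |x|^m at the price of a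
    factor n^m ([poly_cutoff_le]). With the Jacobian of the foliation as weight,
    integration over the parabolas gives K <= C n^(d+1) / b^(d-1)
    ([christoffel_cusp]), which is of order n^sigma.

    Lower bound. At a vertex (alpha <= 2), at a point of the diagonal
    (2 <= alpha) or at a corner of the cube, B touches a hyperplane in such a way
    that its sections at depth t have diameter of order t^gamma. Powers of Fejer
    kernels give univariate polynomials q of degree n with q(0) = 1 and decay
    (1 + n^2 t)^-k ([peak_poly]); as a function of the depth, q has square integral
    of order n^-sigma over B ([ridge_integral_le]).

    The geometry rests on Taylor bounds for |a + h|^alpha with remainder
    |h|^min(alpha, 2), obtained from the convexity or concavity of |b|^alpha as a
    function of b^2. *)

Set Implicit Arguments.
Unset Strict Implicit.
Unset Printing Implicit Defensive.
Import Order.TTheory GRing.Theory Num.Theory.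
Import numFieldNormedType.Exports.

Local Open Scope classical_set_scope.
Local Open Scope ring_scope.

Lemma sum_mul_sqr_le (R : realType) n (a b : 'I_n -> R) :
  (\sum_i a i * b i) ^+ 2 <= (\sum_i a i ^+ 2) * (\sum_i b i ^+ 2).
Proof.
have h : 0 <= \sum_i \sum_j (a i * b j - a j * b i) ^+ 2.
  by apply: sumr_ge0 => i _; apply: sumr_ge0 => j _; exact: sqr_ge0.
suff e : \sum_i \sum_j (a i * b j - a j * b i) ^+ 2 =
   2 * ((\sum_i a i ^+ 2) * (\sum_i b i ^+ 2) - (\sum_i a i * b i) ^+ 2).
  by move: h; rewrite e; lra.
have e1 : (\sum_i a i ^+ 2) * (\sum_i b i ^+ 2) =
    \sum_i \sum_j a i ^+ 2 * b j ^+ 2.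
  by rewrite mulr_suml; apply: eq_bigr => i _; rewrite mulr_sumr.
have e2 : (\sum_i a i ^+ 2) * (\sum_i b i ^+ 2) =
    \sum_i \sum_j a j ^+ 2 * b i ^+ 2 by rewrite e1 exchange_big.
have e3 : (\sum_i a i * b i) ^+ 2 = \sum_i \sum_j (a i * b i) * (a j * b j).
  by rewrite expr2 mulr_suml; apply: eq_bigr => i _; rewrite mulr_sumr.
rewrite mulrBr mulr_natl mulr2n {1}e1 e2 e3 -big_split mulr_sumr -sumrB.
apply: eq_bigr => i _; rewrite -big_split mulr_sumr -sumrB.
by apply: eq_bigr => j _ /=; ring.
Qed.

(** * Integrals of polynomials through antiderivatives *)

Section monotone.
Context {R : realType}.

Lemma derive_ge0_le (f f' : R -> R) (a b : R) : a <= b ->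
  (forall x : R, is_derive x (1 : R) f (f' x)) ->
  (forall x, a <= x <= b -> 0 <= f' x) -> f a <= f b.
Proof.
move=> ab df f'0.
have cf : continuous f.
  move=> x; apply/differentiable_continuous/derivable1_diffP.
  by have [] := df x.
apply: (@ger0_derive1_le_cc _ f a b) => [x _|x||||//].
- by have [] := df x.
- rewrite in_itv/= => /andP[ax xb].
  have [_] := df x; rewrite derive1E => ->.
  by apply: f'0; rewrite (ltW ax) (ltW xb).
- exact: continuous_subspaceT.
- by rewrite in_itv/= lexx.
- by rewrite in_itv/= ab lexx.
Qed.

Definition primp (P : {poly R}) : {poly R} :=
  \poly_(i < (size P).+1) (P`_i.-1 / i%:R).

Lemma deriv_primp P : (primp P)^`() = P.
Proof.
apply/polyP => i; rewrite coef_deriv coef_poly ltnS /=.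
case: ltnP => [_|Pi]; last by rewrite mul0rn nth_default.
by rewrite -[LHS]mulr_natr divfK// pnatr_eq0.
Qed.

(** The integral of P over [a, b], taken through an antiderivative: linearity
    is algebraic and monotonicity is the mean value theorem, so the
    one-dimensional inequalities need no measure theory. *)
Definition dint (P : {poly R}) (a b : R) := (primp P).[b] - (primp P).[a].

Lemma dint_ge0 P a b : a <= b -> (forall x, a <= x <= b -> 0 <= P.[x]) ->
  0 <= dint P a b.
Proof.
move=> ab P0; rewrite subr_ge0.
apply: (@derive_ge0_le _ (fun x => P.[x])) => // x.
by rewrite -{2}[P]deriv_primp; exact: is_derive_poly.
Qed.

Lemma dint_unique P F a b : F^`() = P -> dint P a b = F.[b] - F.[a].
Proof.
move=> FP; suff : F - primp P = ((F - primp P)`_0)%:P.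
  move=> h; have := congr1 (fun p : {poly R} => p.[b] - p.[a]) h.
  by rewrite !hornerE /dint => h'; lra.
apply/polyP => -[|i]; rewrite coefC//=.
have /eqP : F^`()`_i = (primp P)^`()`_i by rewrite deriv_primp FP.
rewrite !coef_deriv -subr_eq0 -mulrnBl mulrn_eq0/= subr_eq0 => /eqP h.
by rewrite coefB h subrr.
Qed.

Lemma dintD P Q a b : dint (P + Q) a b = dint P a b + dint Q a b.
Proof.
rewrite (@dint_unique _ (primp P + primp Q)) ?derivD ?deriv_primp//.
by rewrite /dint !hornerD; ring.
Qed.

Lemma dintN P a b : dint (- P) a b = - dint P a b.
Proof.
rewrite (@dint_unique _ (- primp P)) ?derivN ?deriv_primp//.
by rewrite /dint !hornerN; ring.
Qed.

Lemma dintZ k P a b : dint (k *: P) a b = k * dint P a b.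
Proof.
rewrite (@dint_unique _ (k *: primp P)) ?derivZ ?deriv_primp//.
by rewrite /dint !hornerZ; ring.
Qed.

Lemma dintC (k a b : R) : dint k%:P a b = k * (b - a).
Proof.
rewrite (@dint_unique _ (k *: 'X)) ?derivZ ?derivX ?alg_polyC//.
by rewrite !hornerZ !hornerX; ring.
Qed.

Lemma dint_le P Q a b : a <= b -> (forall x, a <= x <= b -> P.[x] <= Q.[x]) ->
  dint P a b <= dint Q a b.
Proof.
move=> ab PQ; rewrite -subr_ge0 -dintN -dintD; apply: dint_ge0 => // x abx.
by rewrite hornerD hornerN subr_ge0 PQ.
Qed.

Lemma dint_cat P a b c : dint P a b + dint P b c = dint P a c.
Proof. by rewrite /dint; ring. Qed.

Lemma dint_opp P a b : dint (P \Po (- 'X)) a b = dint P (- b) (- a).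
Proof.
rewrite (@dint_unique _ (- (primp P \Po (- 'X)))).
  by rewrite /dint !hornerN !horner_comp !hornerN !hornerX; ring.
by rewrite derivN deriv_comp derivN derivX deriv_primp mulrN1 opprK.
Qed.

End monotone.

(** * A one-dimensional Nikolskii inequality away from the origin *)

Section sine_expansion.
Context {R : realType}.
Implicit Types (Q : {poly R}).

Definition sine_sum (n : nat) (b : nat -> R) (t : R) : R :=
  \sum_(k < n) b k * sin (k.+1%:R * t).

Definition is_sine_sum n (f : R -> R) := exists b, f =1 sine_sum n b.

Lemma is_sine_sumD n f g :
  is_sine_sum n f -> is_sine_sum n g -> is_sine_sum n (fun t => f t + g t).
Proof.
move=> [a fa] [b gb]; exists (fun k => a k + b k) => t.
by rewrite fa gb -big_split; apply: eq_bigr => k _ /=; rewrite mulrDl.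
Qed.

Lemma is_sine_sumZ n c f : is_sine_sum n f -> is_sine_sum n (fun t => c * f t).
Proof.
move=> [a fa]; exists (fun k => c * a k) => t.
by rewrite fa mulr_sumr; apply: eq_bigr => k _ /=; rewrite mulrA.
Qed.

Lemma is_sine_sum0 n : is_sine_sum n (fun=> 0).
Proof. by exists (fun=> 0) => t; rewrite /sine_sum big1// => k _; rewrite mul0r. Qed.

Lemma is_sine_sum_sin n k : (k <= n)%N -> is_sine_sum n (fun t => sin (k%:R * t)).
Proof.
case: k => [_|k kn].
  by have [b hb] := is_sine_sum0 n; exists b => t; rewrite mul0r sin0.
exists (fun i => (i == k)%:R) => t.
rewrite /sine_sum (bigD1 (Ordinal kn))//= eqxx mul1r big1 ?addr0// => i.
by rewrite -val_eqE/= => /negPf ->; rewrite mul0r.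
Qed.

Lemma is_sine_sum_sum n (I : Type) (r : seq I) (F : I -> R -> R) :
  (forall i, is_sine_sum n (F i)) -> is_sine_sum n (fun t => \sum_(i <- r) F i t).
Proof.
move=> hF; elim: r => [|i r IH].
  by have [b hb] := is_sine_sum0 n; exists b => t; rewrite big_nil.
by have [b hb] := is_sine_sumD (hF i) IH; exists b => t; rewrite big_cons -hb.
Qed.

(** The polynomials U_k of Chebyshev (second kind) satisfy
    U_k(cos t) sin t = sin ((k+1) t). Rather than introducing them, the
    expansion is built by Horner induction: multiplying by cos t sends
    sin (k t) to the half sum of sin ((k+1) t) and sin ((k-1) t). *)
Lemma sine_expansion n Q : (size Q <= n)%N ->
  is_sine_sum n (fun t => Q.[cos t] * sin t).
Proof.
elim: n Q => [|n IH] Q.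
  rewrite leqn0 size_poly_eq0 => /eqP ->.
  by have [b hb] := is_sine_sum0 0; exists b => t; rewrite horner0 mul0r -hb.
elim/poly_ind: Q => [_|Q c _].
  by have [b hb] := is_sine_sum0 n.+1; exists b => t; rewrite horner0 mul0r -hb.
rewrite size_MXaddC; case: ifP => [/andP[/eqP -> /eqP ->] _|_ sQ].
  have [b hb] := is_sine_sum0 n.+1; exists b => t.
  by rewrite mul0r add0r horner0 mul0r -hb.
have [a ha] := IH Q sQ.
have h1 : is_sine_sum n.+1 (fun t => c * sin (1%:R * t)).
  by apply: is_sine_sumZ; exact: is_sine_sum_sin.
have h2 : is_sine_sum n.+1 (fun t => \sum_(k < n)
    (a k / 2 * (sin (k.+2%:R * t) + sin (k%:R * t)))).
  apply: is_sine_sum_sum => k; apply: is_sine_sumZ.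
  apply: is_sine_sumD; apply: is_sine_sum_sin; first by rewrite ltnS ltn_ord.
  by rewrite ltnW// ltnS ltnW.
have [b hb] := is_sine_sumD h1 h2; exists b => t; rewrite -hb.
rewrite hornerMXaddC mulrDl addrC mulr1n mul1r; congr (_ + _).
rewrite mulrAC ha /sine_sum mulr_suml; apply: eq_bigr => k _.
have e2 : k.+2%:R * t = k.+1%:R * t + t :> R.
  by rewrite -(addn1 k.+1) natrD mulrDl mul1r.
have e0 : k%:R * t = k.+1%:R * t - t :> R.
  by rewrite -(addn1 k) natrD mulrDl mul1r addrK.
by rewrite e2 e0 sinD sinB; field.
Qed.

Lemma is_derive_sin_scaled (c t : R) :
  is_derive t (1 : R) (fun t => sin (c * t)) (cos (c * t) * c).
Proof.
apply: (@is_derive1_comp _ (@sin R) ( *%R c) t).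
by apply: is_derive_eq; rewrite /GRing.scale/= mulr1.
Qed.

(** An antiderivative of cos (c t), including the degenerate frequency 0. *)
Definition cos_prim (c t : R) := if c == 0 then t else sin (c * t) / c.

Lemma is_derive_cos_prim (c t : R) :
  is_derive t (1 : R) (cos_prim c) (cos (c * t)).
Proof.
rewrite /cos_prim; case: eqP => [->|/eqP c0].
  by rewrite mul0r cos0; exact: is_derive_id.
rewrite (_ : (fun t => _) = c^-1 *: (fun t => sin (c * t))); last first.
  by apply/funext => x /=; rewrite /GRing.scale/= mulrC.
have h := is_derive_sin_scaled c t.
by apply: is_derive_eq; rewrite /GRing.scale/= mulrC mulfK.
Qed.

Definition sinsin_prim (j k : nat) (t : R) : R :=
  (cos_prim (j%:R - k%:R) t - cos_prim (j + k).+2%:R t) / 2.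

Lemma is_derive_sinsin_prim j k (t : R) :
  is_derive t (1 : R) (sinsin_prim j k) (sin (j.+1%:R * t) * sin (k.+1%:R * t)).
Proof.
rewrite (_ : sinsin_prim j k =
  2^-1 *: (cos_prim (j%:R - k%:R) - cos_prim (j + k).+2%:R)); last first.
  by apply/funext => x /=; rewrite /sinsin_prim mulrC.
have h1 := is_derive_cos_prim (j%:R - k%:R) t.
have h2 := is_derive_cos_prim (j + k).+2%:R t.
apply: is_derive_eq; rewrite /GRing.scale/=.
have -> : (j%:R - k%:R) * t = j.+1%:R * t - k.+1%:R * t :> R.
  by rewrite -!(addn1 j) -!(addn1 k) !natrD; ring.
have -> : (j + k).+2%:R * t = j.+1%:R * t + k.+1%:R * t :> R.
  by rewrite -mulrDl -natrD addSn addnS.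
by rewrite cosB cosD; field.
Qed.

Lemma sin_natmul_pi n : sin (n%:R * pi) = 0 :> R.
Proof.
elim: n => [|n IH]; first by rewrite mul0r sin0.
by rewrite -addn1 natrD mulrDl mul1r sinD IH sinpi mul0r mulr0 addr0.
Qed.

Lemma sinsin_prim0 j k : sinsin_prim j k 0 = 0.
Proof. by rewrite /sinsin_prim /cos_prim !mulr0 sin0 !mul0r !if_same subrr mul0r. Qed.

Lemma sinsin_prim_pi j k : sinsin_prim j k pi = (j == k)%:R * (pi / 2).
Proof.
rewrite /sinsin_prim {2}/cos_prim pnatr_eq0/= sin_natmul_pi mul0r subr0.
rewrite /cos_prim subr_eq0 eqr_nat; case: eqP => _; first by rewrite mul1r.
by rewrite mulrBl sinB !sin_natmul_pi !mul0r mulr0 subrr !mul0r.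
Qed.

(** Substituting x = cos t, the right-hand side is the integral over [0, pi] of
    Q(cos t)^2 sin t, which dominates that of (Q(cos t) sin t)^2; the latter is
    computed by orthogonality of the sines. Both integrals are handled through
    antiderivatives: the difference of the two antiderivatives increases. *)
Lemma sine_parseval (Q : {poly R}) n b :
  (fun t => Q.[cos t] * sin t) =1 sine_sum n b ->
  pi / 2 * \sum_(k < n) b k ^+ 2 <= dint (Q ^+ 2) (-1) 1.
Proof.
move=> Qb.
(* an antiderivative of the square of the sine sum *)
pose F := \sum_(j < n) \sum_(k < n) (b j * b k) *: sinsin_prim j k.
have dF (t : R) : is_derive t (1 : R) F ((Q.[cos t] * sin t) ^+ 2).
  have -> : (Q.[cos t] * sin t) ^+ 2 = \sum_(j < n) \sum_(k < n)
      (b j * b k) *: (sin (j.+1%:R * t) * sin (k.+1%:R * t)).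
    rewrite Qb /sine_sum expr2 mulr_suml; apply: eq_bigr => j _.
    by rewrite mulr_sumr; apply: eq_bigr => k _; rewrite mulrACA.
  apply: is_derive_sum => j; apply: is_derive_sum => k; apply: is_deriveZ.
  exact: is_derive_sinsin_prim.
have F0 : F 0 = 0.
  rewrite /F fct_sumE big1// => j _; rewrite fct_sumE big1// => k _.
  by rewrite -[LHS]/(b j * b k * sinsin_prim j k 0) sinsin_prim0 mulr0.
have Fpi : F pi = pi / 2 * \sum_(k < n) b k ^+ 2.
  rewrite /F fct_sumE mulr_sumr; apply: eq_bigr => j _.
  rewrite fct_sumE (bigD1 j)//= big1 ?addr0 => [|k kj].
    rewrite -[LHS]/(b j * b j * sinsin_prim j j pi) sinsin_prim_pi eqxx.
    by rewrite mul1r mulrC expr2.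
  rewrite -[LHS]/(b j * b k * sinsin_prim j k pi) sinsin_prim_pi.
  have /negPf -> : val j != val k by rewrite eq_sym val_eqE.
  by rewrite mul0r mulr0.
pose G := primp (Q ^+ 2).
have dG (t : R) : is_derive t (1 : R) (fun t => G.[cos t])
    ((Q ^+ 2).[cos t] * (- sin t)).
  have := is_derive_poly G (cos t); rewrite [G^`()]deriv_primp => ?.
  exact: (@is_derive1_comp _ (fun x => G.[x]) (@cos R)).
have dH (t : R) : is_derive t (1 : R) (- (fun t => G.[cos t]) - F)
    (- ((Q ^+ 2).[cos t] * (- sin t)) - (Q.[cos t] * sin t) ^+ 2).
  have := dG t; have := dF t => *.
  exact: is_deriveB.
have := @derive_ge0_le _ _ _ 0 pi (pi_ge0 _) dH.
have -> : (- (fun t => G.[cos t]) - F) 0 = - G.[1].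
  by rewrite -[LHS]/(- G.[cos 0] - F 0) F0 subr0 cos0.
have -> : (- (fun t => G.[cos t]) - F) pi =
     - G.[-1] - pi / 2 * \sum_(k < n) b k ^+ 2.
  by rewrite -[LHS]/(- G.[cos pi] - F pi) Fpi cospi.
rewrite /dint -/G => h.
suff : - G.[1] <= - G.[-1] - pi / 2 * \sum_(k < n) b k ^+ 2 by lra.
apply: h => t t0; rewrite horner_exp mulrN opprK.
rewrite exprMn -mulrBr mulr_ge0 ?sqr_ge0//.
have := sin_ge0_pi t0; have := sin_le1 t; nra.
Qed.

(** At interior points the square of a polynomial of degree below n is bounded
    by n times its mean square (and not n^2, as it would be at an endpoint): a sine
    sum with n terms is bounded by Cauchy-Schwarz. *)
Lemma poly_pointwise_le (Q : {poly R}) n (x : R) : (size Q <= n)%N ->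
  -1 <= x <= 1 -> Q.[x] ^+ 2 * (1 - x ^+ 2) <= n%:R * dint (Q ^+ 2) (-1) 1.
Proof.
move=> /sine_expansion[b Qb] x1.
have bI := sine_parseval Qb.
have I0 : 0 <= \sum_(k < n) b k ^+ 2 by apply: sumr_ge0 => k _; exact: sqr_ge0.
have bI' : \sum_(k < n) b k ^+ 2 <= dint (Q ^+ 2) (-1) 1.
  by apply: le_trans bI; have := @pi_ge2 R; nra.
apply: (@le_trans _ _ (n%:R * \sum_(k < n) b k ^+ 2)); last exact: ler_wpM2l.
have := Qb (acos x); rewrite acosK// => Qx.
have -> : Q.[x] ^+ 2 * (1 - x ^+ 2) = (sine_sum n b (acos x)) ^+ 2.
  by rewrite -Qx exprMn sin_acos// sqr_sqrtr//; nra.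
apply: (le_trans (sum_mul_sqr_le _ _)); rewrite mulrC; apply: ler_wpM2r => //.
rewrite -[X in _ <= X%:R]card_ord -sum1_card natr_sum; apply: ler_sum => k _.
by rewrite sin2cos2 gerBl sqr_ge0.
Qed.

Definition evenp (P : {poly R}) : {poly R} := P + (P \Po (- 'X)).

Lemma horner_evenp P x : (evenp P).[x] = P.[x] + P.[- x].
Proof. by rewrite /evenp hornerD horner_comp hornerN hornerX. Qed.

Lemma dint_evenp P a : dint (evenp P) 0 a = dint P (- a) a.
Proof. by rewrite /evenp dintD dint_opp oppr0 addrC dint_cat. Qed.

(** By [poly_pointwise_le] the interval of radius 1/(12n) carries at most half
    of the mass of Q^2. It may therefore be dropped, and outside of it the weight
    x^m is at least (12n)^-m, so that it costs a factor n^m. *)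
Lemma poly_cutoff_le (Q : {poly R}) n m : (0 < n)%N -> (size Q <= n.+1)%N ->
  Q.[0] ^+ 2 <= 4 * 12 ^+ m * n%:R ^+ m.+1 *
    dint (evenp (Q ^+ 2) * 'X^m) ((12 * n%:R)^-1) 1.
Proof.
move=> n0 sQ; set I := dint (Q ^+ 2) (-1) 1; set E := evenp (Q ^+ 2).
set tau := (12 * n%:R)^-1.
have n1 : 1 <= n%:R :> R by rewrite ler1n.
have Q0 x : 0 <= (Q ^+ 2).[x] by rewrite horner_exp sqr_ge0.
have E0 x : 0 <= E.[x] by rewrite horner_evenp addr_ge0.
have I0 : 0 <= I by apply: dint_ge0 => // ; rewrite -subr_ge0; lra.
have tau0 : 0 < tau by rewrite invr_gt0; lra.
have tau12 : tau * (12 * n%:R) = 1 by rewrite mulVf//; lra.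
have tau1 : tau <= 2^-1 by nra.
have nI : n.+1%:R * I <= 2 * n%:R * I.
  by apply: ler_wpM2r => //; rewrite -(addn1 n) natrD; lra.
have h1 : Q.[0] ^+ 2 <= 2 * n%:R * I.
  apply: le_trans nI; have := poly_pointwise_le sQ (x := 0).
  by rewrite expr0n subr0 mulr1; apply; lra.
(* E <= 6 n I on [0, 1/2], because 1 - x^2 >= 3/4 there *)
have h2 : dint E 0 tau <= I / 2.
  apply: (@le_trans _ _ (dint ((6 * n%:R * I)%:P) 0 tau)).
    apply: dint_le => [|x x0]; first exact: ltW.
    have hx := poly_pointwise_le sQ (x := x).
    have hx' := poly_pointwise_le sQ (x := - x).
    rewrite hornerC horner_evenp !horner_exp.
    have : Q.[x] ^+ 2 * (1 - x ^+ 2) <= n.+1%:R * I by apply: hx; lra.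
    have : Q.[- x] ^+ 2 * (1 - x ^+ 2) <= n.+1%:R * I.
      by rewrite -(sqrrN x); apply: hx'; lra.
    have : 3 / 4 <= 1 - x ^+ 2 by nra.
    have := sqr_ge0 Q.[x]; have := sqr_ge0 Q.[- x].
    set a := _ ^+ 2; set b := _ ^+ 2; set c := 1 - _; nra.
  rewrite dintC subr0; nra.
have h3 : I <= 2 * dint E tau 1.
  have : dint E 0 tau + dint E tau 1 = I by rewrite dint_cat dint_evenp.
  lra.
have h4 : tau ^+ m * dint E tau 1 <= dint (E * 'X^m) tau 1.
  rewrite -dintZ; apply: dint_le => [|x /andP[x0 x1]]; first lra.
  rewrite hornerZ hornerM hornerXn mulrC ler_wpM2l//.
  by rewrite lerXn2r// nnegrE; lra.
apply: (le_trans h1); apply: (@le_trans _ _ (4 * n%:R * dint E tau 1)); first nra.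
have -> : 4 * n%:R * dint E tau 1 =
    4 * 12 ^+ m * n%:R ^+ m.+1 * (tau ^+ m * dint E tau 1).
  have : (tau * (12 * n%:R)) ^+ m = 1 by rewrite tau12 expr1n.
  rewrite !exprMn exprS; move: (tau ^+ m) (12 ^+ m) (n%:R ^+ m) => u v w uvw.
  by rewrite -[LHS]mulr1 -uvw; ring.
apply: ler_wpM2l => //; rewrite !mulr_ge0// exprn_ge0//.
Qed.

End sine_expansion.

(** * Polynomials of one variable peaking at an endpoint *)

Section fejer.
Context {R : realType}.

Fixpoint fejer2 (n : nat) : {poly R} * {poly R} :=
  if n is m.+1 then
    let: (p, q) := fejer2 m in (q, 2%:P * (1 - 2%:P * 'X) * q + 2%:P - p)
  else (0, 1).

(** The Fejer kernel in the variable t = (sin x)^2: [fejer_sin] says that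
    fejer n (t) = (sin (n x) / sin x)^2. The recursion is that of
    (1 - T_n) / (1 - X), T_n being the Chebyshev polynomials, at 1 - 2 t. *)
Definition fejer n := (fejer2 n).1.

Lemma fejer0 : fejer 0 = 0. Proof. by []. Qed.
Lemma fejer1 : fejer 1 = 1. Proof. by []. Qed.
Lemma fejerSS n :
  fejer n.+2 = 2%:P * (1 - 2%:P * 'X) * fejer n.+1 + 2%:P - fejer n.
Proof. by rewrite /fejer /=; case: (fejer2 n). Qed.

Lemma nat_ind2 (P : nat -> Prop) : P 0 -> P 1 ->
  (forall n, P n -> P n.+1 -> P n.+2) -> forall n, P n.
Proof.
move=> P0 P1 PS n; suff : P n /\ P n.+1 by case.
by elim: n => // n [Pn PSn]; split=> //; exact: PS.
Qed.

Lemma size_fejer n : (size (fejer n) <= n)%N.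
Proof.
elim/nat_ind2: n => [||n IH1 IH2]; rewrite ?fejer0 ?fejer1 ?size_poly0 ?size_poly1//.
rewrite fejerSS (leq_trans (size_polyD _ _))// geq_max size_polyN.
rewrite (leq_trans IH1) ?andbT; last by rewrite ltnW// ltnS leqnSn.
rewrite (leq_trans (size_polyD _ _))// geq_max.
rewrite (leq_trans (size_polyC_leq1 _)) ?andbT//.
rewrite -mulrA mul_polyC (leq_trans (size_scale_leq _ _))//.
rewrite (leq_trans (size_polyMleq _ _))//.
have s2 : (size (1 - 2%:P * 'X : {poly R})%R <= 2)%N.
  rewrite (leq_trans (size_polyD _ _))// geq_max size_poly1 size_polyN/=.
  by rewrite mul_polyC (leq_trans (size_scale_leq _ _))// size_polyX.
by rewrite -subn1 leq_subLR (leq_trans (leq_add s2 IH2)).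

Qed.

Lemma fejer_at0 n : (fejer n).[0] = n%:R ^+ 2.
Proof.
elim/nat_ind2: n => [||n IH1 IH2]; rewrite ?fejer0 ?fejer1 ?horner0 ?hornerC
  ?expr0n ?expr1n//.
rewrite fejerSS !(hornerD, hornerN, hornerM, hornerC, hornerX) IH1 IH2.
by rewrite -!(addn1 n.+1) -(addn1 n) !natrD; ring.
Qed.

Lemma fejer_sin n (x : R) :
  (fejer n).[sin x ^+ 2] * sin x ^+ 2 = sin (n%:R * x) ^+ 2.
Proof.
elim/nat_ind2: n => [||n IH1 IH2].
- by rewrite fejer0 horner0 !mul0r sin0 expr0n.
- by rewrite fejer1 hornerC !mul1r.
rewrite fejerSS !(hornerD, hornerN, hornerM, hornerC, hornerX).
set F := (fejer n.+1).[_] in IH2 *; set G := (fejer n).[_] in IH1 *.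
rewrite (_ : _ * _ = 2 * (1 - 2 * sin x ^+ 2) * (F * sin x ^+ 2)
  + 2 * sin x ^+ 2 - G * sin x ^+ 2); last by ring.
rewrite IH1 IH2.
have -> : n.+2%:R * x = n.+1%:R * x + x :> R.
  by rewrite -(addn1 n.+1) natrD mulrDl mul1r.
have -> : n%:R * x = n.+1%:R * x - x :> R.
  by rewrite -(addn1 n) natrD mulrDl mul1r addrK.
rewrite sinB sinD; move: (n.+1%:R * x) => A.
have h1 := cos2sin2 x; have h2 := cos2sin2 A.
rewrite -[LHS]/(2 * (1 - 2 * sin x ^+ 2) * sin A ^+ 2 + 2 * sin x ^+ 2
   - (sin A * cos x - cos A * sin x) ^+ 2).
have -> : forall a b c d : R, (a * b + c * d) ^+ 2 =
   2 * (a ^+ 2 * b ^+ 2 + c ^+ 2 * d ^+ 2) - (a * b - c * d) ^+ 2 by move=> *; ring.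
by rewrite h1 h2; ring.
Qed.

Lemma norm_sin_natmul n (x : R) : `|sin (n%:R * x)| <= n%:R * `|sin x|.
Proof.
elim: n => [|n IH]; first by rewrite mul0r sin0 normr0 mul0r.
rewrite -addn1 natrD !mulrDl !mul1r sinD (le_trans (ler_normD _ _))//.
rewrite !normrM; apply: lerD.
  by apply: le_trans IH; rewrite ler_piMr// cos_max.
by rewrite ler_piMl// cos_max.
Qed.

(** The two upper bounds say that fejer n, divided by n^2, is at most
    min(1, 1/(n^2 t)): it equals 1 at t = 0 and decays at scale n^-2. *)
Lemma fejer_bounds n (t : R) : 0 <= t <= 1 ->
  [/\ 0 <= (fejer n).[t], (fejer n).[t] <= n%:R ^+ 2 & (fejer n).[t] * t <= 1].
Proof.
move=> /andP[]; rewrite le_eqVlt => /predU1P[<- _|t0 t1].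
  by rewrite fejer_at0 mulr0; split=> //; exact: sqr_ge0.
have t01 : -1 <= Num.sqrt t <= 1.
  rewrite (le_trans _ (sqrtr_ge0 _)); last by lra.
  by rewrite -[X in _ <= X]sqrtr1 ler_wsqrtr.
have st : sin (asin (Num.sqrt t)) ^+ 2 = t by rewrite asinK// sqr_sqrtr// ltW.
have := fejer_sin n (asin (Num.sqrt t)); rewrite st => h.
have h0 : 0 <= (fejer n).[t] * t by rewrite h sqr_ge0.
have hn : (fejer n).[t] * t <= n%:R ^+ 2 * t.
  rewrite h -{2}st -exprMn -(@ler_sqrt _ (_ ^+ 2)) ?sqr_ge0// !sqrtr_sqr normrM.
  by rewrite (ger0_norm (ler0n _ _)); exact: norm_sin_natmul.
split; first by rewrite -(pmulr_lge0 _ t0).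
  by rewrite -(ler_pM2r t0).
rewrite h -(@ler_sqrt _ (_ ^+ 2)) // sqrtr1 sqrtr_sqr; exact: sin_max.
Qed.

Lemma within_continuous_inv_sqr (a T : R) : 0 < a ->
  {within `[0, T], continuous (fun t => (1 + a * t) ^- 2)}.
Proof.
move=> a0; apply: continuous_in_subspaceT => x.
rewrite inE/= in_itv/= => /andP[x0 _].
apply: cvgV; first by rewrite expf_neq0// gt_eqF// ltr_pwDl// mulr_ge0// ltW.
have c1 : (1 + a * t) @[t --> x] --> 1 + a * x.
  by apply: cvgD; [exact: cvg_cst|apply: cvgMr; exact: cvg_id].
by rewrite expr2; under eq_fun do rewrite expr2; apply: cvgM.
Qed.

Lemma integral_inv_sqr_le (a T : R) : 0 < a -> 0 < T ->
  (\int[lebesgue_measure]_(t in `[0%R, T]) ((1 + a * t) ^- 2)%:E <= (a^-1)%:E)%E.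
Proof.
move=> a0 T0.
have p x : 0 <= x -> 1 + a * x != 0.
  by move=> x0; rewrite gt_eqF// ltr_pwDl// mulr_ge0// ltW.
have dl (x : R) : is_derive x (1:R) (fun t => 1 + a * t) a.
  have h : is_derive x (1 : R) ( *%R a) a.
    by apply: is_derive_eq; rewrite /GRing.scale/= mulr1.
  by have := is_deriveD (is_derive_cst (1 : R) x 1) h; rewrite add0r.
have dF (x : R) : 0 <= x -> is_derive x (1 : R) (fun t => - (a^-1 * (1 + a * t)^-1))
    ((1 + a * x) ^- 2).
  move=> /p x0; have h := @is_deriveV _ (fun t => 1 + a * t) _ _ _ x0 (dl x).
  have -> : (fun t => - (a^-1 * (1 + a * t)^-1)) =
      (- a^-1) *: (fun t => (1 + a * t)^-1).
    by apply/funext => t; rewrite -mulNr.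
  apply: is_derive_eq.
  by rewrite /GRing.scale/=; field; rewrite x0 gt_eqF.
rewrite (@continuous_FTC2 _ _ (fun t => - (a^-1 * (1 + a * t)^-1)))//.
- rewrite mulr0 addr0 invr1 mulr1 -EFinB lee_fin opprK gerDr oppr_le0.
  by rewrite mulr_ge0// invr_ge0 ?addr_ge0 ?mulr_ge0// ltW.
- exact: within_continuous_inv_sqr.
- have cF (x : R) : 0 <= x -> {for x, continuous (fun t => - (a^-1 * (1 + a * t)^-1))}.
    move=> x0; apply/differentiable_continuous/derivable1_diffP.
    by have [] := dF _ x0.
  split.
  + by move=> x; rewrite in_itv/= => /andP[/ltW x0 _]; have [] := dF _ x0.
  + by apply: cvg_at_right_filter; exact: cF.
  + by apply: cvg_at_left_filter; exact/cF/ltW.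
- move=> x; rewrite in_itv/= => /andP[/ltW x0 _].
  by rewrite derive1E; have [_ ->] := dF _ x0.
Qed.

(** A power q = r^k of the normalized Fejer kernel r peaks at 0 at scale n^-2
    and decays like (1 + n^2 t)^-k. Once 2k >= beta + 2, the integrand is at most
    a constant times n^(-2 beta) (1 + n^2 t)^-2. *)
Lemma peak_poly (T beta : R) : 0 < T -> 0 <= beta ->
  exists2 C : R, 0 < C & forall n, (0 < n)%N -> exists q : {poly R},
    [/\ (size q <= n.+1)%N, q.[0] = 1 &
     (\int[lebesgue_measure]_(t in `[0%R, T]) (q.[t] ^+ 2 * t `^ beta)%:E
       <= (C * n%:R `^ (- (2 * beta + 2)))%:E)%E].
Proof.
move=> T0 beta0.
pose k := (Num.truncn beta).+2.
have k2 : beta + 2 <= 2 * k%:R.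
  have := truncnS_gt beta; rewrite /k -!(addn1 _.+1) natrD.
  have : 1 <= (Num.truncn beta).+1%:R :> R by rewrite ler1n.
  lra.
have k0 : (0 < k)%N by [].
have kR : 1 <= k%:R :> R by rewrite ler1n.
(* B bounds r(t) (1 + n^2 t), since the kernel has order N >= n/k *)
pose B := 1 + T * k%:R ^+ 2.
have B1 : 1 <= B by rewrite lerDl mulr_ge0 ?sqr_ge0// ltW.
exists (B ^+ (2 * k)) => [|n n0]; first by rewrite exprn_gt0//; lra.
pose N := (n %/ k).+1.
have nN : n%:R <= N%:R * k%:R :> R.
  by rewrite -natrM ler_nat ltnW// -ltn_divLR//.
have N0 : 0 < N%:R :> R by rewrite ltr0n.
have nR : 1 <= n%:R :> R by rewrite ler1n.
pose r : {poly R} := N%:R ^- 2 *: (fejer N \Po (T^-1 *: 'X)).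
have rE t : r.[t] = N%:R ^- 2 * (fejer N).[t / T].
  by rewrite hornerZ horner_comp hornerZ hornerX [T^-1 * t]mulrC.
have sr : (size r <= N)%N.
  rewrite (leq_trans (size_scale_leq _ _))//.
  rewrite (leq_trans (size_comp_poly_leq _ _))// ltnS.
  rewrite size_scale ?invr_eq0 ?gt_eqF// size_polyX muln1.
  by have := size_fejer N; case: (size _).
exists (r ^+ k); split.
- rewrite (leq_trans (size_poly_exp_leq _ _))// ltnS.
  rewrite (@leq_trans ((n %/ k) * k))// ?leq_divM// leq_mul2r.
  by rewrite -subn1 leq_subLR add1n sr orbT.
- by rewrite horner_exp rE mul0r fejer_at0 mulVf ?expr1n// expf_neq0// gt_eqF.
have n2 : 0 < n%:R ^+ 2 :> R by rewrite exprn_gt0//; lra.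
have key t : 0 <= t <= T -> (r ^+ k).[t] ^+ 2 * t `^ beta <=
    B ^+ (2 * k) * n%:R `^ (- (2 * beta)) * (1 + n%:R ^+ 2 * t) ^- 2.
  move=> /andP[t0 tT].
  have tT1 : 0 <= t / T <= 1.
    by rewrite divr_ge0 ?(ltW T0)//= ler_pdivrMr// mul1r.
  have [f0 f1 f2] := fejer_bounds N tT1.
  have r0 : 0 <= r.[t] by rewrite rE mulr_ge0// invr_ge0 sqr_ge0.
  have r1 : r.[t] <= 1 by rewrite rE mulrC ler_pdivrMr ?mul1r// exprn_gt0.
  pose w := n%:R ^+ 2 * t.
  have w0 : 0 <= w by rewrite mulr_ge0// ltW.
  have rw : r.[t] * (1 + w) <= B.
    rewrite mulrDr mulr1; apply: lerD => //.
    have -> : r.[t] * w = T * ((fejer N).[t / T] * (t / T)) * (n%:R ^+ 2 / N%:R ^+ 2).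
      by rewrite rE /w; field; rewrite !gt_eqF.
    apply: ler_pM => //.
    + by apply: mulr_ge0; [exact: ltW|apply: mulr_ge0 => //; case/andP: tT1].
    + by rewrite -[leRHS]mulr1 ler_pM2l.
    + rewrite ler_pdivrMr ?exprn_gt0// -exprMn lerXn2r ?nnegrE ?mulr_ge0//.
      by rewrite mulrC.
  have nt : t `^ beta = n%:R `^ (- (2 * beta)) * w `^ beta.
    rewrite /w powRM ?(ltW n2)// mulrA -powR_mulrn ?ler0n// -powRrM.
    rewrite -powRD ?addNr ?powRr0 ?mul1r//.
    by apply/implyP => _; rewrite gt_eqF//; lra.
  rewrite nt horner_exp -exprM mulnC -/w mulrCA.
  rewrite [B ^+ _ * _]mulrC -[leRHS]mulrA ler_wpM2l ?powR_ge0//.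
  rewrite ler_pdivlMr ?exprn_gt0//; last lra.
  have wb : w `^ beta <= (1 + w) ^+ (2 * k - 2).
    apply: (@le_trans _ _ ((1 + w) `^ beta)).
      by apply: ge0_ler_powR; rewrite ?nnegrE//; lra.
    rewrite -powR_mulrn; last lra.
    apply: ler_powR; first lra.
    by rewrite natrB ?natrM//; lra.
  rewrite -mulrA.
  apply: (@le_trans _ _ (r.[t] ^+ (2 * k) * ((1 + w) ^+ (2 * k - 2) * (1 + w) ^+ 2))).
    apply: ler_wpM2l; first exact: exprn_ge0.
    by apply: ler_wpM2r => //; exact: sqr_ge0.
  rewrite -exprD subnK// -exprMn lerXn2r// nnegrE ?mulr_ge0//; lra.
apply: (@le_trans _ _ (\int[lebesgue_measure]_(t in `[0%R, T])
   ((B ^+ (2 * k) * n%:R `^ (- (2 * beta)))%:E * ((1 + n%:R ^+ 2 * t) ^- 2)%:E))%E).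
  apply: ge0_le_integral => //.
  - by move=> x _; rewrite lee_fin mulr_ge0 ?sqr_ge0 ?powR_ge0.
  - apply/measurable_EFinP; apply: measurable_funM.
      apply: measurable_funTS; apply: measurable_funX.
      by apply: continuous_measurable_fun; exact: continuous_horner.
    by apply: measurable_funTS; exact: measurable_powR.
  - apply/measurable_EFinP.
    apply: measurable_funM; first exact: measurable_cst.
    apply: subspace_continuous_measurable_fun => //.
    exact: within_continuous_inv_sqr.
rewrite ge0_integralZl//; last 3 first.
- apply/measurable_EFinP; apply: subspace_continuous_measurable_fun => //.
  exact: within_continuous_inv_sqr.
- by move=> x _; rewrite lee_fin invr_ge0 sqr_ge0.
- by rewrite lee_fin mulr_ge0 ?powR_ge0// exprn_ge0//; lra.
have C0 : 0 <= B ^+ (2 * k) * n%:R `^ (- (2 * beta)).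
  by rewrite mulr_ge0 ?powR_ge0// exprn_ge0//; lra.
apply: (le_trans (lee_wpmul2l _ (integral_inv_sqr_le n2 T0))).
  by rewrite lee_fin.
rewrite -EFinM lee_fin -mulrA ler_wpM2l ?exprn_ge0//; first by lra.
rewrite -powR_mulrn// -powRN -powRD ?opprD//.
by apply/implyP => _; rewrite gt_eqF//; lra.
Qed.

End fejer.

(** * Lebesgue measure under affine maps and shears *)

Section affine.
Context {R : realType}.
Local Notation leb := (@lebesgue_measure R).

Definition affine (a b : R) : measurableTypeR R -> measurableTypeR R :=
  fun x => a * x + b.

Lemma measurable_affine a b : measurable_fun setT (affine a b).
Proof.
apply: measurable_funD; last exact: measurable_cst.
by apply: measurable_funM; [exact: measurable_cst|exact: measurable_id].
Qed.

Lemma preimage_affine_itv (a b c d : R) : a != 0 ->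
  leb (affine a b @^-1` `]c, d]) = leb `](c - b) / `|a|, (d - b) / `|a|].
Proof.
rewrite neq_lt => /orP[a0|a0].
  rewrite (_ : _ @^-1` _ = `[(d - b) / a, (c - b) / a[%classic); last first.
    apply/seteqP; split => x; rewrite /affine /= !in_itv/= -lerBrDr -ltrBlDr.
      by rewrite ler_ndivrMr// ltr_ndivlMr// !(mulrC x) andbC.
    by rewrite ler_ndivrMr// ltr_ndivlMr// !(mulrC x) andbC.
  rewrite !lebesgue_measure_itv/= !lte_fin ltr0_norm// !invrN !mulrN ltrN2.
  by case: ifP => // _; rewrite -!EFinB; congr EFin; ring.
rewrite gtr0_norm//; congr (leb _); apply/seteqP; split => x;
  rewrite /affine /= !in_itv/= -lerBrDr -ltrBlDr.
  by rewrite ler_pdivlMr// ltr_pdivrMr// !(mulrC x).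
by rewrite ler_pdivlMr// ltr_pdivrMr// !(mulrC x).
Qed.

Definition affine_image (a b : R) : set (measurableTypeR R) -> \bar R :=
  pushforward leb (affine a b).

HB.instance Definition _ a b := Measure.copy (affine_image a b)
  (measure_function_pushforward__canonical__measure_function_Measure
     leb (measurable_affine a b)).

(** By uniqueness of Lebesgue measure: both sides agree on intervals. *)
Lemma lebesgue_affine (a b : R) (A : set R) : a != 0 -> measurable A ->
  leb A = mscale (NngNum (normr_ge0 a)) (affine_image a b) A.
Proof.
move=> a0 mA; apply: lebesgue_measure_unique => // X.
have n0 : 0 < `|a| by rewrite normr_gt0.
move=> [[c d] _ <-]/=; rewrite /mscale/= /affine_image /pushforward.
rewrite preimage_affine_itv// !lebesgue_measure_itv/= !lte_fin.
rewrite ltr_pM2r ?invr_gt0// ltrD2r; case: ifP => _; last by rewrite mule0.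
by rewrite -!EFinB -EFinM; congr EFin; field; rewrite gt_eqF.
Qed.

Lemma integral_affine (a b : R) (F : R -> \bar R) : a != 0 ->
  measurable_fun setT F -> (forall x, 0 <= F x)%E ->
  (\int[leb]_x F x = `|a|%:E * \int[leb]_x F (a * x + b)%R)%E.
Proof.
move=> a0 mF F0.
rewrite (@eq_measure_integral _ _ _ _
    (mscale (NngNum (normr_ge0 a)) (affine_image a b))); last first.
  by move=> A mA _; exact: lebesgue_affine.
rewrite ge0_integral_mscale// ge0_integral_pushforward//.
exact: measurable_affine.
Qed.

End affine.

Section tuples.
Context {R : realType}.
Local Notation leb := (@lebesgue_measure R).
Local Notation leb_ := (lebesgue_tuple R).
Local Open Scope ereal_scope.

Lemma integral_cons d (F : d.+1.-tuple R -> \bar R) :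
  measurable_fun setT F -> (forall x, 0 <= F x) ->
  \int[leb_ d.+1]_x F x = \int[leb]_a \int[leb_ d]_y F (cons_pair (a, y)).
Proof.
move=> mF F0.
have mc := @measurable_cons_pair R d.
transitivity (\int[leb \x leb_ d]_p F (cons_pair p)).
  by rewrite /= /lebesgue_cons ge0_integral_pushforward// preimage_setT.
rewrite fubini_tonelli1//; apply: measurableT_comp => //.
Qed.

Lemma measurable_integral_tuple d d1 (T : measurableType d1)
    (G : T * d.-tuple R -> \bar R) :
  measurable_fun setT G -> (forall q, 0 <= G q) ->
  measurable_fun setT (fun t => \int[leb_ d]_y G (t, y)).
Proof. by move=> mG G0; exact: measurable_fun_fubini_tonelli_F. Qed.

(** The coordinate singled out below is the largest one of a boundary point, so
    the variable to be split off is not always the first one. *)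
Definition ins {d} (j : 'I_d.+1) (a : R) (y : d.-tuple R) : d.+1.-tuple R :=
  [tuple (if unlift j i is Some k then tnth y k else a) | i < d.+1].

Lemma tnth_ins_id d j a (y : d.-tuple R) : tnth (ins j a y) j = a.
Proof. by rewrite tnth_mktuple unlift_none. Qed.

Lemma tnth_ins_lift d j a (y : d.-tuple R) k :
  tnth (ins j a y) (lift j k) = tnth y k.
Proof. by rewrite tnth_mktuple liftK. Qed.

Lemma measurable_ins d d1 (T : measurableType d1) (j : 'I_d.+1)
    (f : T -> R) (g : T -> d.-tuple R) :
  measurable_fun setT f -> measurable_fun setT g ->
  measurable_fun setT (fun x => ins j (f x) (g x)).
Proof.
move=> mf mg; apply/measurable_fun_tnthP => i.
have [k|] := unliftP j i => ->.
  rewrite (_ : _ \o _ = (fun x => tnth (g x) k)).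
    by apply: (measurableT_comp (measurable_tnth k)).
  by apply/funext => x /=; rewrite tnth_ins_lift.
rewrite (_ : _ \o _ = f)//.
by apply/funext => x /=; rewrite tnth_ins_id.
Qed.

Lemma ins0E d a (y : d.-tuple R) : ins ord0 a y = cons_pair (a, y).
Proof.
apply: eq_from_tnth => i; have [k|] := unliftP ord0 i => ->.
  by rewrite tnth_ins_lift tnthS.
by rewrite tnth_ins_id.
Qed.

Lemma ins_cons d (k : 'I_d.+1) (a b : R) (z : d.-tuple R) :
  ins (lift ord0 k) b (cons_pair (a, z)) = cons_pair (a, ins k b z).
Proof.
apply: eq_from_tnth => i; have [l|] := unliftP ord0 i => ->.
  rewrite tnthS; have [m|] := unliftP k l => ->.
    rewrite tnth_ins_lift (_ : lift ord0 (lift k m) = lift (lift ord0 k) (lift ord0 m)).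
      by rewrite tnth_ins_lift tnthS.
    by apply: val_inj; rewrite /= /bump !leq0n !add1n ltnS addnS.
  by rewrite !tnth_ins_id.
rewrite tnth0 (_ : ord0 = lift (lift ord0 k) ord0); last exact: val_inj.
by rewrite tnth_ins_lift tnth0.
Qed.

(** By induction on the dimension: the inserted coordinate is exchanged with the
    first one by Tonelli's theorem. *)
Lemma integral_ins d (j : 'I_d.+1) (F : d.+1.-tuple R -> \bar R) :
  measurable_fun setT F -> (forall x, 0 <= F x) ->
  \int[leb_ d.+1]_x F x = \int[leb]_a \int[leb_ d]_y F (ins j a y).
Proof.
elim: d j F => [|d IH] j F mF F0.
  rewrite integral_cons//; apply: eq_integral => a _; apply: eq_integral => y _.
  by rewrite -ins0E (ord1 j).
have [k|] := unliftP ord0 j => ->; last first.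
  rewrite integral_cons//; apply: eq_integral => a _; apply: eq_integral => y _.
  by rewrite -ins0E.
rewrite integral_cons//.
under eq_integral => a _.
  rewrite (IH k)//; last first.
    by apply: measurableT_comp => //; apply: measurableT_comp => //;
      exact: measurable_cons_pair.
  over.
rewrite (@fubini_tonelli _ _ _ _ _ leb leb
  (fun p => \int[leb_ d]_y F (cons_pair (p.1, ins k p.2 y))))/=; last 2 first.
- apply: (@measurable_integral_tuple _ _ _
    (fun q => F (cons_pair (q.1.1, ins k q.1.2 q.2)))) => [|q]; last exact: F0.
  apply: measurableT_comp => //; apply: measurableT_comp => //.
    exact: measurable_cons_pair.
  apply: measurable_fun_pair; first exact: measurableT_comp.
  by apply: measurable_ins => //; exact: measurableT_comp.
- by move=> p; apply: integral_ge0.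
apply: eq_integral => b _; rewrite integral_cons//; last first.
  by apply: measurableT_comp => //; exact: measurable_ins.
apply: eq_integral => a _; apply: eq_integral => z _; congr F.
by rewrite ins_cons.
Qed.

Lemma integral_scale_shift d (s : R) (v : 'I_d -> R) (F : d.-tuple R -> \bar R) :
  s != 0%R -> measurable_fun setT F -> (forall x, 0 <= F x) ->
  \int[leb_ d]_y F y =
  (`|s| ^+ d)%:E * \int[leb_ d]_y F [tuple (s * tnth y i + v i)%R | i < d].
Proof.
move=> s0.
elim: d v F => [|d IH] v F mF F0.
  rewrite mul1e; apply: eq_integral => y _; congr F.
  by rewrite (tuple0 y) [RHS]tuple0.
have mG (a : R) : measurable_fun setT (fun y => F (cons_pair (a, y))).
  by apply: measurableT_comp => //; apply: measurableT_comp => //;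
    exact: measurable_cons_pair.
have mT n (w : 'I_n -> R) : measurable_fun setT
    (fun y : n.-tuple R => [tuple (s * tnth y i + w i)%R | i < n]).
  apply/measurable_fun_tnthP => i.
  rewrite (_ : _ \o _ = (fun y : n.-tuple R => s * tnth y i + w i)%R); last first.
    by apply/funext => y /=; rewrite tnth_mktuple.
  apply: measurable_funD; last exact: measurable_cst.
  by apply: measurable_funM; [exact: measurable_cst|exact: measurable_tnth].
rewrite !integral_cons//; last exact: (measurableT_comp mF (mT d.+1 v)).
under eq_integral => a _ do rewrite (IH (fun i => v (lift ord0 i)))//.
rewrite ge0_integralZl//; last 2 first.
- apply: (@measurable_integral_tuple _ _ _
    (fun q => F (cons_pair (q.1,
      [tuple (s * tnth q.2 i + v (lift ord0 i))%R | i < d])))) => [|q];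
    last exact: F0.
  apply: measurableT_comp => //; apply: measurableT_comp => //.
    exact: measurable_cons_pair.
  apply: measurable_fun_pair => //.
  exact: (measurableT_comp (mT d (fun i => v (lift ord0 i)))).
- by move=> a _; apply: integral_ge0.
rewrite [in LHS](@integral_affine _ s (v ord0))//; last 2 first.
- apply: (@measurable_integral_tuple _ _ _
    (fun q => F (cons_pair (q.1,
      [tuple (s * tnth q.2 i + v (lift ord0 i))%R | i < d])))) => [|q];
    last exact: F0.
  apply: measurableT_comp => //; apply: measurableT_comp => //.
    exact: measurable_cons_pair.
  apply: measurable_fun_pair => //.
  exact: (measurableT_comp (mT d (fun i => v (lift ord0 i)))).
- by move=> a; apply: integral_ge0.
rewrite muleA -EFinM -exprSr; congr (_ * _).
apply: eq_integral => a _; apply: eq_integral => y _; congr F.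
apply: eq_from_tnth => i; rewrite tnth_mktuple.
have [l|] := unliftP ord0 i => ->; first by rewrite !tnthS tnth_mktuple.
by rewrite !tnth0.
Qed.

(** For fixed y the coordinate j is transformed by an affine map of ratio c,
    whatever the dependence of the translation on y. *)
Lemma integral_shear d (j : 'I_d.+1) (c : R) (g : d.-tuple R -> R)
    (F : d.+1.-tuple R -> \bar R) :
  c != 0%R -> measurable_fun setT g ->
  measurable_fun setT F -> (forall x, 0 <= F x) ->
  \int[leb_ d.+1]_x F x =
  `|c|%:E * \int[leb]_t \int[leb_ d]_y F (ins j (c * t + g y)%R y).
Proof.
move=> c0 mg mF F0; rewrite (integral_ins j)//.
have mins (T : measurableType _) (h1 : T -> R) (h2 : T -> d.-tuple R) :
    measurable_fun setT h1 -> measurable_fun setT h2 ->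
    measurable_fun setT (fun x => F (ins j (h1 x) (h2 x))).
  by move=> m1 m2; apply: measurableT_comp => //; exact: measurable_ins.
rewrite (@fubini_tonelli _ _ _ _ _ leb (leb_ d)
  (fun p => F (ins j p.1 p.2)))//=; last first.
  by apply: mins; [exact: measurable_fst|exact: measurable_snd].
under eq_integral => y _.
  rewrite (@integral_affine _ c (g y))//; last first.
    by apply: mins; [exact: measurable_id|exact: measurable_cst].
  over.
have maff : measurable_fun setT
   (fun p : d.-tuple R * measurableTypeR R => (c * p.2 + g p.1)%R).
  apply: measurable_funD; last exact: (measurableT_comp mg).
  by apply: measurable_funM; [exact: measurable_cst|exact: measurable_snd].
rewrite ge0_integralZl//; last 2 first.
- apply: (@measurable_fun_fubini_tonelli_F _ _ _ _ R leb
    (fun p => F (ins j (c * p.2 + g p.1)%R p.1))) => //.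
  by apply: mins => //; exact: measurable_fst.
- by move=> y _; exact: integral_ge0.
congr (_ * _).
rewrite (@fubini_tonelli _ _ _ _ _ (leb_ d) leb
  (fun p => F (ins j (c * p.2 + g p.1)%R p.1)))//.
by apply: mins => //; exact: measurable_fst.
Qed.

End tuples.

(** * Restriction of a polynomial to parabolas *)

Section curves.
Context {R : realType}.
Local Notation leb := (@lebesgue_measure R).
Local Notation leb_ := (lebesgue_tuple R).

(** Substitution of univariate polynomials for the variables: the restriction of
    p to a polynomial curve. *)
Definition poly_curve d (p : {mpoly R[d]}) (h : 'I_d -> {poly R}) : {poly R} :=
  \sum_(m <- msupp p) p@_m *: \prod_(i < d) h i ^+ m i.

Lemma horner_poly_curve d (p : {mpoly R[d]}) h x (y : d.-tuple R) :
  (forall i, tnth y i = (h i).[x]) -> (poly_curve p h).[x] = peval p y.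
Proof.
move=> yh; rewrite /peval mevalE horner_sum; apply: eq_bigr => m _.
rewrite hornerZ horner_prod; congr (_ * _); apply: eq_bigr => i _.
by rewrite horner_exp yh.
Qed.

Lemma size_mul_le (p q : {poly R}) a b : (size p <= a.+1)%N ->
  (size q <= b.+1)%N -> (size (p * q)%R <= (a + b).+1)%N.
Proof.
move=> pa qb; rewrite (leq_trans (size_polyMleq _ _))//.
by rewrite -subn1 leq_subLR (leq_trans (leq_add pa qb))// addnS addSn add1n.
Qed.

Lemma size_poly_curve d (p : {mpoly R[d]}) (h : 'I_d -> {poly R}) n k :
  (msize p <= n.+1)%N ->
  (forall i, (size (h i) <= k.+1)%N) -> (size (poly_curve p h) <= (k * n).+1)%N.
Proof.
move=> pn hk; rewrite (leq_trans (size_sum _ _ _))//.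
apply/bigmax_leqP_seq => m mp _; rewrite (leq_trans (size_scale_leq _ _))//.
apply: (@leq_trans (k * mdeg m).+1); last first.
  by rewrite ltnS leq_mul2l -ltnS (leq_trans (msize_mdeg_lt mp)) ?orbT.
rewrite mdegE big_distrr/=.
apply: (big_ind2 (fun (q : {poly R}) a => size q <= a.+1)%N) => [|p1 a q b|i _].
- by rewrite size_poly1.
- exact: size_mul_le.
- rewrite (leq_trans (size_poly_exp_leq _ _))// ltnS leq_mul2r.
  by rewrite -subn1 leq_subLR add1n hk orbT.
Qed.

Lemma measurable_peval d (p : {mpoly R[d]}) :
  measurable_fun setT (peval p : d.-tuple R -> R).
Proof.
rewrite (_ : peval p = fun x => \sum_(m <- msupp p)
    p@_m * \prod_(i < d) tnth x i ^+ m i); last first.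
  by apply/funext => x; rewrite /peval mevalE.
apply: measurable_sum => m; apply: measurable_funM; first exact: measurable_cst.
apply: measurable_prod => i _; apply: measurable_funX; exact: measurable_tnth.
Qed.

(** The change of variables t = x^2. *)
Lemma dint_sqrt_itv (E : {poly R}) d (tau : R) : 0 < tau < 1 ->
  (\int[leb]_(t in `[(tau ^+ 2)%R, 1%R]) (Num.sqrt t ^+ d * E.[Num.sqrt t])%:E
   = (2 * dint (E * 'X^(d.+1))%R tau 1)%:E)%E.
Proof.
move=> /andP[tau0 tau1].
have t21 : tau ^+ 2 < 1 by rewrite expr_lt1// ltW.
have t20 : 0 < tau ^+ 2 by rewrite exprn_gt0.
pose G := primp (E * 'X^(d.+1)).
have dF (t : R) : 0 < t -> is_derive t (1 : R) (fun t => 2 * G.[Num.sqrt t])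
     (Num.sqrt t ^+ d * E.[Num.sqrt t]).
  move=> t0; have ds := is_derive1_sqrt t0.
  have := is_derive_poly G (Num.sqrt t); rewrite [G^`()]deriv_primp => dG.
  have dc := @is_derive1_comp _ (fun x => G.[x]) (@Num.sqrt R) _ _ _ dG ds.
  have -> : (fun t => 2 * G.[Num.sqrt t]) =
     2 *: ((fun x => G.[x]) \o (@Num.sqrt R)) by apply/funext.
  apply: is_derive_eq; rewrite /GRing.scale/= hornerM hornerXn exprS.
  by field; rewrite gt_eqF// sqrtr_gt0.
have cs (q : {poly R}) : continuous (fun t : R => q.[Num.sqrt t]).
  move=> x; apply: (@continuous_comp _ _ _ (@Num.sqrt R) (fun x => q.[x])).
    exact: sqrt_continuous.
  exact: continuous_horner.
have cF : continuous (fun t : R => 2 * G.[Num.sqrt t]).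
  by move=> x; apply: cvgMr; exact: cs.
have e2 : 2 * dint (E * 'X^(d.+1)) tau 1 =
   2 * G.[Num.sqrt 1] - 2 * G.[Num.sqrt (tau ^+ 2)].
  by rewrite sqrtr1 sqrtr_sqr gtr0_norm// -mulrBr.
rewrite e2 EFinB; apply: (@continuous_FTC2 _ _ (fun t => 2 * G.[Num.sqrt t])) => //.
- rewrite (_ : (fun t => _) = (fun t => ('X^d * E).[Num.sqrt t])).
    by apply: continuous_subspaceT; exact: cs.
  by apply/funext => t; rewrite hornerM hornerXn.
- split.
  + move=> x; rewrite in_itv/= => /andP[x0 _].
    by have [] := dF _ (lt_trans t20 x0).
  + by apply: cvg_at_right_filter; exact: cF.
  + by apply: cvg_at_left_filter; exact: cF.
- move=> x; rewrite in_itv/= => /andP[x0 _].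
  by rewrite derive1E; have [_ ->] := dF _ (lt_trans t20 x0).
Qed.

End curves.

Section cusp.
Context {R : realType}.
Local Notation leb := (@lebesgue_measure R).
Local Notation leb_ := (lebesgue_tuple R).

(** For fixed u, x |-> cusp x0 j s b a g x u is a parabola through x0, followed
    in both directions. The coordinates other than j move by
    y = a x^2 + b x u, and coordinate j by s x^2 - sum g y: the vector g tilts the
    cusp along a hyperplane, and s x^2 is the displacement away from it. With
    t = x^2 the map (t, u) |-> cusp has Jacobian |s| (b sqrt t)^d. *)
Definition cusp d (x0 : d.+1.-tuple R) (j : 'I_d.+1) (s b : R) (a g : 'I_d -> R)
    (x : R) (u : d.-tuple R) : d.+1.-tuple R :=
  ins j (tnth x0 j + s * x ^+ 2
         - \sum_i g i * (a i * x ^+ 2 + b * x * tnth u i))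
    [tuple tnth x0 (lift j i) + (a i * x ^+ 2 + b * x * tnth u i) | i < d].

(** On the parabola p becomes a polynomial of degree 2n in x, to which
    [poly_cutoff_le] applies with the weight |x|^(d+1), that is t^(d/2) dt in the
    variable t = x^2. *)
Lemma cusp_curve_le d (x0 : d.+1.-tuple R) j s b a g u n (p : {mpoly R[d.+1]}) :
  (0 < n)%N -> (msize p <= n.+1)%N ->
  ((peval p x0 ^+ 2 / (2 * 12 ^+ d.+1 * (2 * n)%:R ^+ d.+2))%:E <=
  \int[leb]_(t in `[((24 * n%:R) ^- 2)%R, 1%R])
    (Num.sqrt t ^+ d * (peval p (cusp x0 j s b a g (Num.sqrt t) u) ^+ 2
      + peval p (cusp x0 j s b a g (- Num.sqrt t) u) ^+ 2))%:E)%E.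
Proof.
move=> n0 pn.
pose y i : {poly R} := a i *: 'X^2 + (b * tnth u i) *: 'X.
pose h (i : 'I_d.+1) : {poly R} :=
  if unlift j i is Some k then (tnth x0 (lift j k))%:P + y k
  else (tnth x0 j)%:P + s *: 'X^2 - \sum_i g i *: y i.
have sy i : (size (y i) <= 3)%N.
  rewrite (leq_trans (size_polyD _ _))// geq_max.
  by rewrite !(leq_trans (size_scale_leq _ _))// ?size_polyXn// size_polyX.
have sh i : (size (h i) <= 3)%N.
  rewrite /h; case: unlift => [k|].
    rewrite (leq_trans (size_polyD _ _))// geq_max sy.
    by rewrite (leq_trans (size_polyC_leq1 _)).
  rewrite (leq_trans (size_polyD _ _))// geq_max size_polyN; apply/andP; split.
    rewrite (leq_trans (size_polyD _ _))// geq_max (leq_trans (size_polyC_leq1 _))//=.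
    by rewrite (leq_trans (size_scale_leq _ _))// size_polyXn.
  rewrite (leq_trans (size_sum _ _ _))//; apply/bigmax_leqP => i0 _.
  by rewrite (leq_trans (size_scale_leq _ _)).
have yE i x : (y i).[x] = a i * x ^+ 2 + b * x * tnth u i.
  by rewrite /y hornerD !hornerZ hornerXn hornerX; ring.
have hE x i : tnth (cusp x0 j s b a g x u) i = (h i).[x].
  rewrite /cusp /h; have [k|] := unliftP j i => ->.
    by rewrite tnth_ins_lift tnth_mktuple hornerD hornerC yE.
  rewrite tnth_ins_id !(hornerD, hornerN) hornerC hornerZ hornerXn horner_sum.
  by congr (_ - _); apply: eq_bigr => k _; rewrite hornerZ yE.
pose P := poly_curve p h.
have PE x : P.[x] = peval p (cusp x0 j s b a g x u).
  exact: horner_poly_curve.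
have P0 : P.[0] = peval p x0.
  rewrite PE; congr peval; apply: eq_from_tnth => i; rewrite hE /h.
  have [k|] := unliftP j i => ->.
    by rewrite hornerD hornerC yE expr0n !(mulr0,mul0r,addr0).
  rewrite !(hornerD, hornerN) hornerC hornerZ hornerXn horner_sum.
  rewrite big1 ?expr0n ?subr0 ?mulr0 ?addr0// => k _.
  by rewrite hornerZ yE expr0n !(mulr0,mul0r,addr0).
have sP : (size P <= (2 * n).+1)%N by exact: size_poly_curve.
have n2 : (0 < 2 * n)%N by rewrite muln_gt0.
have := @poly_cutoff_le _ P (2 * n) d.+1 n2 sP; rewrite P0.
have -> : 12 * (2 * n)%:R = 24 * n%:R :> R by rewrite natrM mulrA -natrM.
have nR : 1 <= n%:R :> R by rewrite ler1n.
have tau01 : 0 < (24 * n%:R : R)^-1 < 1.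
  by rewrite invr_gt0 invf_lt1; lra.
move=> H; have := @dint_sqrt_itv R (evenp (P ^+ 2)) d _ tau01.
rewrite -exprVn => e; under eq_integral => t _.
  rewrite -!PE -!horner_exp -horner_evenp; over.
rewrite e lee_fin.
have N0 : 0 < (2 * n)%:R :> R by rewrite ltr0n.
rewrite ler_pdivrMr; last first.
  by apply: mulr_gt0; [apply: mulr_gt0 => //|]; exact: exprn_gt0.
apply: le_trans H _; set A := dint _ _ _; set B := _ ^+ d.+1; set C := _ ^+ d.+2.
by rewrite le_eqVlt; apply/orP; left; apply/eqP; ring.
Qed.

End cusp.

(** * The Christoffel function at the tip of a cusp *)

Section cusp_integral.
Context {R : realType}.
Local Notation leb := (@lebesgue_measure R).
Local Notation leb_ := (lebesgue_tuple R).

Lemma measurable_mktuple d d1 (T : measurableType d1) (f : 'I_d -> T -> R) :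
  (forall i, measurable_fun setT (f i)) ->
  measurable_fun setT (fun x => [tuple f i x | i < d]).
Proof.
move=> mf; apply/measurable_fun_tnthP => i.
rewrite (_ : _ \o _ = f i)//.
by apply/funext => x /=; rewrite tnth_mktuple.
Qed.

Lemma measurable_box d (A : 'I_d -> set R) : (forall i, measurable (A i)) ->
  measurable [set x : d.-tuple R | forall i, A i (tnth x i)].
Proof.
move=> mA.
rewrite (_ : mkset _ = \bigcap_(i : 'I_d) ((@tnth _ R ^~ i) @^-1` A i)).
  apply: fin_bigcap_measurable => // i _.
  by rewrite -[X in measurable X]setTI; exact: measurable_tnth.
by apply/seteqP; split => x Ax; [move=> i _; exact: Ax|move=> i; exact: (Ax i)].
Qed.

Lemma measurable_cusp d d1 (T : measurableType d1) (x0 : d.+1.-tuple R) j s b a g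
    (e : T -> R) (w : T -> d.-tuple R) :
  measurable_fun setT e -> measurable_fun setT w ->
  measurable_fun setT (fun z => cusp x0 j s b a g (e z) (w z)).
Proof.
move=> me mw.
have my i : measurable_fun setT (fun z => a i * e z ^+ 2 + b * e z * tnth (w z) i).
  apply: measurable_funD; apply: measurable_funM => //.
  - exact: measurable_funX.
  - by apply: measurable_funM.
  - exact: (measurableT_comp (measurable_tnth i)).
apply: measurable_ins; last first.
  by apply: measurable_mktuple => i; apply: measurable_funD.
apply: measurable_funB.
  by apply: measurable_funD => //; apply: measurable_funM => //; exact: measurable_funX.
by apply: measurable_sum => i; apply: measurable_funM.
Qed.

(** The bound of [cusp_curve_le] is integrated over u in the unit cube, and the
    resulting double integral is recognized as part of the integral of p^2 over
    D. The two directions x > 0 and x < 0 of the parabolas sweep the regions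
    of u and -u, each inside D, whence the factor 2. Only the part
    |x| >= 1/(24n) of the parabolas has to lie in D. *)
Lemma christoffel_cusp d (D : set (d.+1.-tuple R)) x0 j (s b : R) a g n
    (p : {mpoly R[d.+1]}) :
  measurable D -> (0 < n)%N -> (msize p <= n.+1)%N -> s != 0 -> 0 < b ->
  (forall x (u : d.-tuple R), (24 * n%:R)^-1 <= `|x| <= 1 ->
     (forall i, 0 <= tnth u i <= 1) -> D (cusp x0 j s b a g x u)) ->
  ((`|s| * b ^+ d * (peval p x0 ^+ 2 / (2 * 12 ^+ d.+1 * (2 * n)%:R ^+ d.+2)))%:E
   <= 2%:E * \int[leb_ d.+1]_(x in D) (peval p x ^+ 2)%:E)%E.
Proof.
move=> mD n0 pn s0 b0 cuspD.
set kappa := peval p x0 ^+ 2 / _.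
pose F : d.+1.-tuple R -> \bar R := (fun x => (peval p x ^+ 2)%:E) \_ D.
have mp2 : measurable_fun setT (fun x : d.+1.-tuple R => (peval p x ^+ 2)%:E).
  by apply/measurable_EFinP; apply: measurable_funX; exact: measurable_peval.
have mF : measurable_fun setT F.
  by apply/(measurable_restrictT _ _).1 => //; exact: measurable_funTS.
have F0 x : (0 <= F x)%E by apply: erestrict_ge0 => y _; rewrite lee_fin sqr_ge0.
rewrite integral_mkcond -/F.
pose g' (y : d.-tuple R) :=
  tnth x0 j - \sum_i g i * (tnth y i - tnth x0 (lift j i)).
have mg' : measurable_fun setT g'.
  apply: measurable_funB => //; apply: measurable_sum => i.
  apply: measurable_funM => //; apply: measurable_funB => //.
  exact: measurable_tnth.
rewrite (integral_shear j s0 mg')//.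
(* the slice of the integral at depth s * t in direction j *)
pose H t := (\int[leb_ d]_y F (ins j (s * t + g' y)%R y))%E.
have mH : measurable_fun setT H.
  apply: (measurable_integral_tuple
    (G := fun q => F (ins j (s * q.1 + g' q.2)%R q.2))) => //.
  apply: measurableT_comp => //; apply: measurable_ins => //.
  apply: measurable_funD; last exact: (measurableT_comp mg').
  by apply: measurable_funM.
have H0 t : (0 <= H t)%E by exact: integral_ge0.
(* the slice is scaled by b e, for either square root e of t *)
have HE (t e : R) : 0 < t -> e ^+ 2 = t -> `|e| = Num.sqrt t -> H t =
   (((b * Num.sqrt t) ^+ d)%R%:E * \int[leb_ d]_u F (cusp x0 j s b a g e u))%E.
  move=> t0 e2 eE.
  have e0 : e != 0 by rewrite -sqrf_eq0 e2 gt_eqF.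
  rewrite /H (@integral_scale_shift _ _ (b * e)
     (fun i => tnth x0 (lift j i) + a i * t)) ?mulf_neq0 ?(gt_eqF b0)//; last first.
    apply: measurableT_comp => //; apply: measurable_ins => //.
    by apply: measurable_funD => //.
  rewrite normrM gtr0_norm// eE; congr (_ * _)%E; apply: eq_integral => u _.
  congr F; rewrite /cusp e2.
  have -> : [tuple b * e * tnth u i + (tnth x0 (lift j i) + a i * t) | i < d] =
      [tuple tnth x0 (lift j i) + (a i * t + b * e * tnth u i)  | i < d].
    by apply: eq_from_tnth => i; rewrite !tnth_mktuple; ring.
  congr ins; rewrite /g' addrA [s * t + _]addrC; congr (_ - _).
  apply: eq_bigr => i _.
  by rewrite tnth_mktuple addrC addKr.
pose tau : R := (24 * n%:R)^-1.
pose I := `[(24 * n%:R : R) ^- 2, 1%R]%classic.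
pose box := [set u : d.-tuple R | forall i, `[0%R, 1%R]%classic (tnth u i)].
have mbox : measurable box by exact: (@measurable_box _ (fun=> `[0%R, 1%R]%classic)).
have box1 : leb_ d box = 1%E.
  rewrite (lebesgue_tuple_box (A := fun=> `[0%R, 1%R]%classic))// big1// => i _.
  by rewrite lebesgue_measure_itv/= lte_fin ltr01 oppr0 adde0.
have mI : measurable I by exact: measurable_itv.
pose Phi t u := Num.sqrt t ^+ d * (peval p (cusp x0 j s b a g (Num.sqrt t) u) ^+ 2
      + peval p (cusp x0 j s b a g (- Num.sqrt t) u) ^+ 2).
have Phi0 t u : 0 <= Phi t u.
  by rewrite mulr_ge0 ?exprn_ge0 ?sqrtr_ge0// addr_ge0 ?sqr_ge0.
pose G (q : measurableTypeR R * d.-tuple R) : \bar R :=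
  (\1_I q.1 * (\1_box q.2 * Phi q.1 q.2))%:E.
have G0 q : (0 <= G q)%E by rewrite lee_fin; do 2 apply: mulr_ge0 => //; exact: Phi0.
have mG : measurable_fun setT G.
  apply/measurable_EFinP; apply: measurable_funM.
    exact: (measurableT_comp (measurable_indic mI) measurable_fst).
  apply: measurable_funM.
    exact: (measurableT_comp (measurable_indic mbox) measurable_snd).
  have ms : measurable_fun setT
      (fun q : measurableTypeR R * d.-tuple R => Num.sqrt q.1).
    apply: (measurableT_comp (f := @Num.sqrt R)) => //.
    by apply: continuous_measurable_fun; exact: sqrt_continuous.
  apply: measurable_funM; first exact: measurable_funX.
  apply: measurable_funD; apply: measurable_funX;
    apply: (measurableT_comp (measurable_peval p)); apply: measurable_cusp => //.
  exact: measurable_funN.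
have Hle t : ((b ^+ d)%:E * \int[leb_ d]_u G (t, u) <= 2%:E * H t)%E.
  have [It|It] := boolP (t \in I); last first.
    rewrite integral0_eq => [|u _]; first by rewrite mule0 mule_ge0.
    by rewrite /G /= indicE (negbTE It) mul0r.
  move: (It); rewrite inE /I/= in_itv/= => /andP[It1 It2].
  have nR : 1 <= n%:R :> R by rewrite ler1n.
  have tau0 : 0 < (24 * n%:R : R)^-1 by rewrite invr_gt0; lra.
  have t0 : 0 < t by apply: lt_le_trans It1; rewrite -exprVn exprn_gt0.
  have st1 : (24 * n%:R)^-1 <= Num.sqrt t <= 1.
    apply/andP; split; last by rewrite -sqrtr1 ler_wsqrtr.
    by rewrite -(gtr0_norm tau0) -sqrtr_sqr ler_wsqrtr// exprVn.
  have hp : H t = _ :=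
    HE t (Num.sqrt t) t0 (sqr_sqrtr (ltW t0)) (ger0_norm (sqrtr_ge0 _)).
  have hn : H t = _ :=
    HE t (- Num.sqrt t) t0 (etrans (sqrrN _) (sqr_sqrtr (ltW t0)))
      (etrans (normrN _) (ger0_norm (sqrtr_ge0 _))).
  have mc e : measurable_fun setT (fun u : d.-tuple R => F (cusp x0 j s b a g e u)).
    by apply: measurableT_comp => //; exact: measurable_cusp.
  have -> : (2%:E * H t = H t + H t)%E by rewrite mule_natl mule2n.
  rewrite {1}hp hn -ge0_muleDr ?integral_ge0// -ge0_integralD//.
  rewrite exprMn EFinM -muleA lee_wpmul2l ?lee_fin ?exprn_ge0 ?(ltW b0)//.
  rewrite -ge0_integralZl//; last 2 first.
  - exact: emeasurable_funD.
  - by move=> u _; rewrite adde_ge0.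
  apply: ge0_le_integral => //.
  - by apply: (measurableT_comp mG); exact: measurable_pair1.
  - by apply: measurable_funeM; exact: emeasurable_funD.
  move=> u _; rewrite /G /= indicE It mul1r indicE.
  have [bu|_] := boolP (u \in box); last first.
    by rewrite mul0r mule_ge0 ?adde_ge0// lee_fin exprn_ge0// sqrtr_ge0.
  have bu' i : 0 <= tnth u i <= 1.
    by move: bu; rewrite inE => /(_ i); rewrite /= in_itv.
  rewrite mul1r /F !patchE !mem_set ?EFinM//.
  - by apply: cuspD => //; rewrite normrN ger0_norm// sqrtr_ge0.
  - by apply: cuspD => //; rewrite ger0_norm// sqrtr_ge0.
have Gu u : ((kappa * \1_box u)%:E <= \int[leb]_t G (t, u))%E.
  rewrite /G /= indicE; have [bu|_] := boolP (u \in box); last first.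
    by rewrite mulr0 integral0_eq// => t _; rewrite mul0r mulr0.
  rewrite mulr1; apply: (le_trans (cusp_curve_le x0 j s b a g u n0 pn)).
  rewrite integral_mkcond le_eqVlt; apply/orP; left; apply/eqP.
  apply: eq_integral => t _; rewrite patchE indicE mul1r -/(Phi t u) -/I.
  by case: ifP => _; rewrite ?mul1r ?mul0r.
have bd0 : (0 <= (b ^+ d)%:E)%E by rewrite lee_fin exprn_ge0// ltW.
rewrite muleCA EFinM EFinM -muleA lee_wpmul2l ?lee_fin//.
rewrite -ge0_integralZl//; last by move=> t _; exact: H0.
rewrite -/H.
apply: (@le_trans _ _
  (\int[leb]_t ((b ^+ d)%:E * \int[leb_ d]_u G (t, u)))%E); last first.
  apply: ge0_le_integral => //.
  - by move=> t _; rewrite mule_ge0// integral_ge0.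
  - by apply: measurable_funeM; exact: measurable_integral_tuple.
  - exact: measurable_funeM.
rewrite ge0_integralZl//; last 2 first.
- exact: measurable_integral_tuple.
- by move=> t _; exact: integral_ge0.
rewrite lee_wpmul2l// (@fubini_tonelli _ _ _ _ _ leb (leb_ d) G)//.
apply: (@le_trans _ _ (\int[leb_ d]_u (kappa * \1_box u)%:E)%E).
  under eq_integral => u _ do rewrite EFinM.
  rewrite ge0_integralZl//; last 2 first.
  - by apply/measurable_EFinP; exact: measurable_indic.
  - by rewrite lee_fin divr_ge0 ?sqr_ge0// !mulr_ge0// exprn_ge0.
  by rewrite integral_indic// setIT [X in (_ * X)%E]box1 mule1.
apply: ge0_le_integral => //.
- by move=> u _; rewrite lee_fin mulr_ge0// divr_ge0 ?sqr_ge0// !mulr_ge0// exprn_ge0.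
- apply/measurable_EFinP; apply: measurable_funM => //; exact: measurable_indic.
- exact: (@measurable_fun_fubini_tonelli_G _ _ _ _ _ leb).
Qed.

End cusp_integral.

(** * Ridge polynomials *)

Section ridge.
Context {R : realType}.
Local Notation leb := (@lebesgue_measure R).
Local Notation leb_ := (lebesgue_tuple R).

(** The affine function with normal (1, v) that vanishes at x0; it serves as
    depth below a supporting hyperplane at x0. *)
Definition depth d (x0 : d.+1.-tuple R) (v : 'I_d -> R) (x : d.+1.-tuple R) : R :=
  tnth x0 ord0 - tnth x ord0
  + \sum_i v i * (tnth x0 (lift ord0 i) - tnth x (lift ord0 i)).

Definition ridge d (x0 : d.+1.-tuple R) v (q : {poly R}) : {mpoly R[d.+1]} :=
  let T := (tnth x0 ord0)%:MP - 'X_ord0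
    + \sum_i v i *: ((tnth x0 (lift ord0 i))%:MP - 'X_(lift ord0 i)) in
  \sum_(k < size q) q`_k *: T ^+ k.

Lemma peval_ridge d (x0 : d.+1.-tuple R) v q x :
  peval (ridge x0 v q) x = q.[depth x0 v x].
Proof.
rewrite /peval /ridge horner_coef [meval _ _]raddf_sum/=; apply: eq_bigr => k _.
rewrite mevalZ rmorphXn/=; congr (_ * _ ^+ _).
rewrite mevalD mevalB mevalC mevalXU [meval _ (\sum_i _)]raddf_sum/=.
by congr (_ + _); apply: eq_bigr => i _; rewrite mevalZ mevalB mevalC mevalXU.
Qed.

Lemma msize_sum_le d (I : Type) (r : seq I) (P : pred I) (F : I -> {mpoly R[d]}) n :
  (forall i, P i -> msize (F i) <= n)%N -> (msize (\sum_(i <- r | P i) F i) <= n)%N.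
Proof.
move=> hF; elim/big_ind: _ => [|p q hp hq|i Pi]; rewrite ?msize0//; last exact: hF.
by rewrite (leq_trans (msizeD_le _ _))// geq_max hp hq.
Qed.

Lemma msize_mul_le d (p q : {mpoly R[d]}) a b : (msize p <= a.+1)%N ->
  (msize q <= b.+1)%N -> (msize (p * q)%R <= (a + b).+1)%N.
Proof.
have [->|p0] := eqVneq p 0; first by rewrite mul0r msize0.
have [->|q0] := eqVneq q 0; first by rewrite mulr0 msize0.
move=> pa qb; rewrite msizeM// -subn1 leq_subLR.
by rewrite (leq_trans (leq_add pa qb))// addnS addSn add1n.
Qed.

Lemma msize_ridge d (x0 : d.+1.-tuple R) v (q : {poly R}) n : (size q <= n.+1)%N ->
  (msize (ridge x0 v q) <= n.+1)%N.
Proof.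
move=> qn; apply: msize_sum_le => k _; rewrite (leq_trans (msizeZ_le _ _))//.
set T := _ + _.
have B c (i : 'I_d.+1) : (msize (c%:MP - 'X_i : {mpoly R[d.+1]})%R <= 2)%N.
  rewrite (leq_trans (msizeD_le _ _))// geq_max msizeN msizeX mdeg1 andbT.
  by rewrite msizeC; case: (_ == _).
have sT : (msize T <= 2)%N.
  rewrite (leq_trans (msizeD_le _ _))// geq_max B /=.
  by apply: msize_sum_le => i _; rewrite (leq_trans (msizeZ_le _ _)).
apply: leq_trans (leq_trans (ltn_ord k) qn).
elim: (val k) => [|m IH]; first by rewrite expr0 msize1.
by rewrite exprS -(add1n m); exact: msize_mul_le.
Qed.

(** The slice of D at depth t lies in a box of side 2 C t^gamma, so it has measure
    at most (2 C t^gamma)^d. *)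
Lemma ridge_integral_le d (D : set (d.+1.-tuple R)) x0 v (C T gamma : R)
    (q : {poly R}) :
  measurable D -> 0 <= C ->
  (forall x, D x -> 0 <= depth x0 v x <= T /\
     forall i, `|tnth x (lift ord0 i) - tnth x0 (lift ord0 i)| <=
        C * depth x0 v x `^ gamma) ->
  (\int[leb_ d.+1]_(x in D) (peval (ridge x0 v q) x ^+ 2)%:E <=
   ((2 * C) ^+ d)%:E *
   \int[leb]_(t in `[0%R, T]) (q.[t] ^+ 2 * t `^ (gamma * d%:R))%:E)%E.
Proof.
move=> mD C0 DC.
pose F : d.+1.-tuple R -> \bar R := (fun x => (peval (ridge x0 v q) x ^+ 2)%:E) \_ D.
have mp2 : measurable_fun setT
    (fun x : d.+1.-tuple R => (peval (ridge x0 v q) x ^+ 2)%:E).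
  by apply/measurable_EFinP; apply: measurable_funX; exact: measurable_peval.
have mF : measurable_fun setT F.
  by apply/(measurable_restrictT _ _).1 => //; exact: measurable_funTS.
have F0 x : (0 <= F x)%E by apply: erestrict_ge0 => y _; rewrite lee_fin sqr_ge0.
rewrite [leLHS]integral_mkcond -/F.
pose g (y : d.-tuple R) :=
  tnth x0 ord0 + \sum_i v i * (tnth x0 (lift ord0 i) - tnth y i).
have mg : measurable_fun setT g.
  apply: measurable_funD => //; apply: measurable_sum => i.
  apply: measurable_funM => //; apply: measurable_funB => //.
  exact: measurable_tnth.
have n1 : (-1 : R) != 0 by rewrite oppr_eq0 oner_eq0.
(* depth replaces the first coordinate as a variable *)
rewrite (integral_shear ord0 n1 mg)// normrN1 mul1e.
have depthE t y : depth x0 v (ins ord0 (-1 * t + g y) y) = t.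
  rewrite /depth tnth_ins_id /g mulN1r.
  set S1 := \sum_i _; set S2 := \sum_i _.
  suff -> : S2 = S1 by rewrite opprD opprK addrCA opprD addNKr subrK.
  by apply: eq_bigr => i _; rewrite tnth_ins_lift.
have mq : measurable_fun setT (fun t : R => (q.[t] ^+ 2 * t `^ (gamma * d%:R))%:E).
  apply/measurable_EFinP; apply: measurable_funM; last exact: measurable_powR.
  by apply: measurable_funX; apply: continuous_measurable_fun; exact: continuous_horner.
rewrite -ge0_integralZl//; last 3 first.
- exact: measurable_funTS.
- by move=> t _; rewrite lee_fin mulr_ge0 ?sqr_ge0 ?powR_ge0.
- by rewrite lee_fin exprn_ge0// mulr_ge0.
rewrite [leRHS]integral_mkcond; apply: ge0_le_integral => //.
- by move=> t _; exact: integral_ge0.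
- apply: (measurable_integral_tuple
    (G := fun p : measurableTypeR R * d.-tuple R =>
      F (ins ord0 (-1 * p.1 + g p.2)%R p.2))) => //.
  apply: measurableT_comp => //; apply: measurable_ins => //.
  apply: measurable_funD; last exact: (measurableT_comp mg).
  by apply: measurable_funM.
- apply/(measurable_restrictT _ _).1 => //.
  by apply: measurable_funeM; exact: measurable_funTS.
move=> t _; rewrite patchE; case: ifPn => tT; last first.
  rewrite integral0_eq// => y _; rewrite /F patchE; case: ifPn => // /[!inE] /DC[].
  rewrite depthE => tT' _; exfalso; move/negP: tT; apply.
  by rewrite inE/= in_itv.
move: tT; rewrite inE/= in_itv/= => /andP[t0 tT].
pose A (i : 'I_d) : set R := `[tnth x0 (lift ord0 i) - C * t `^ gamma,
  tnth x0 (lift ord0 i) + C * t `^ gamma]%classic.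
pose box := [set y : d.-tuple R | forall i, A i (tnth y i)].
have mA i : measurable (A i) by exact: measurable_itv.
have mbox : measurable box := measurable_box mA.
have ct0 : 0 <= C * t `^ gamma by rewrite mulr_ge0// powR_ge0.
have boxE : leb_ d box = ((2 * C * t `^ gamma) ^+ d)%:E.
  rewrite (lebesgue_tuple_box (A := A))//.
  rewrite (eq_bigr (fun=> (2 * C * t `^ gamma)%:E)) => [|i _].
    by rewrite prodEFin prodr_const card_ord.
  rewrite lebesgue_measure_itv/= lte_fin; case: ltP => h.
    by rewrite -EFinB; congr EFin; ring.
  by congr EFin; lra.
apply: (@le_trans _ _ (\int[leb_ d]_y ((q.[t] ^+ 2)%:E * (\1_box y)%:E))%E).
  apply: ge0_le_integral => //.
  - apply: measurableT_comp => //; apply: measurable_ins => //.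
    by apply: measurable_funD.
  - apply: measurable_funeM; apply/measurable_EFinP; exact: measurable_indic.
  move=> y _; rewrite /F patchE; case: ifPn => Dy; last first.
    by rewrite -EFinM lee_fin mulr_ge0// sqr_ge0.
  rewrite peval_ridge depthE -EFinM lee_fin indicE mem_set ?mulr1//.
  move: Dy; rewrite inE => /DC[_]; rewrite depthE => h i; have := h i.
  rewrite tnth_ins_lift /A /= in_itv/= ler_distl => /andP[h1 h2].
  by apply/andP; split.
rewrite ge0_integralZl//; last 2 first.
- apply/measurable_EFinP; exact: measurable_indic.
- by rewrite lee_fin sqr_ge0.
rewrite integral_indic// setIT [X in (_ * X)%E]boxE -!EFinM lee_fin.
by rewrite powRrM powR_mulrn ?powR_ge0// exprMn mulrCA.
Qed.

End ridge.

(** * Orthonormal bases and the Christoffel function *)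

Section gram_schmidt.
Context {R : realType} {V : lmodType R}.
Variables (B : V -> V -> R) (W : V -> Prop).
Hypothesis BC : forall u v, B u v = B v u.
Hypothesis BD : forall u v w, B (u + v) w = B u w + B v w.
Hypothesis BZ : forall a u v, B (a *: u) v = a * B u v.
Hypothesis Bpos : forall u, W u -> u != 0 -> 0 < B u u.
Hypothesis W0 : W 0.
Hypothesis WD : forall u v, W u -> W v -> W (u + v).
Hypothesis WZ : forall a u, W u -> W (a *: u).

Lemma form0l v : B 0 v = 0.
Proof. by rewrite -(scale0r 0) BZ mul0r. Qed.

Lemma form_sumr (I : Type) (r : seq I) (F : I -> V) u :
  B (\sum_(i <- r) F i) u = \sum_(i <- r) B (F i) u.
Proof.
elim: r => [|i r IH]; first by rewrite !big_nil form0l.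
by rewrite !big_cons BD IH.
Qed.

Definition orthonormal N (phi : 'I_N -> V) :=
  forall i j, B (phi i) (phi j) = (i == j)%:R.

Definition combination N (phi : 'I_N -> V) (u : V) :=
  exists c : 'I_N -> R, u = \sum_k c k *: phi k.

Lemma form_combination N (phi : 'I_N -> V) c j : orthonormal phi ->
  B (\sum_k c k *: phi k) (phi j) = c j.
Proof.
move=> ophi; rewrite form_sumr (bigD1 j)//= BZ ophi eqxx mulr1 big1 ?addr0//.
by move=> i /negPf ij; rewrite BZ ophi ij mulr0.
Qed.

(** Vectors with zero residual are dropped, so s need not be free. The form is
    positive on W only, because the L2 form is known to be definite on spaces of
    polynomials of bounded degree. *)
Lemma gram_schmidt (s : seq V) : (forall u, u \in s -> W u) ->
  exists N (phi : 'I_N -> V), [/\ forall k, W (phi k), orthonormal phi &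
    forall u, u \in s -> combination phi u].
Proof.
elim: s => [_|v s IH Ws].
  by exists 0%N, (fun=> 0); split => // -[].
have [|N [phi [Wphi ophi sphi]]] := IH.
  by move=> u us; apply: Ws; rewrite inE us orbT.
have Wv : W v by apply: Ws; rewrite inE eqxx.
pose p := \sum_k B v (phi k) *: phi k.
have Wp : W p.
  rewrite /p; elim: (index_enum _) => [|k r IHr]; first by rewrite big_nil.
  by rewrite big_cons; apply: WD => //; exact: WZ.
have [vp|vp] := eqVneq (v - p) 0.
  exists N, phi; split=> // u; rewrite inE => /predU1P[->|/sphi//].
  by exists (fun k => B v (phi k)); apply/eqP; rewrite -subr_eq0 vp.
have Wr : W (v - p) by rewrite -scaleN1r; apply: WD => //; exact: WZ.
have r0 := Bpos Wr vp; set r := v - p in vp Wr r0.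
have rphi k : B r (phi k) = 0.
  by rewrite /r -scaleN1r BD BZ form_combination// mulN1r subrr.
pose a := (Num.sqrt (B r r))^-1.
have a0 : a != 0 by rewrite invr_eq0 gt_eqF// sqrtr_gt0.
have aa : a * a * B r r = 1.
  by rewrite /a -expr2 exprVn sqr_sqrtr ?(ltW r0)// mulVf// gt_eqF.
pose psi (i : 'I_N.+1) := if unlift ord0 i is Some k then phi k else a *: r.
have psi0 : psi ord0 = a *: r by rewrite /psi unlift_none.
have psiS k : psi (lift ord0 k) = phi k by rewrite /psi liftK.
exists N.+1, psi; split.
- move=> i; have [k|] := unliftP ord0 i => ->; rewrite ?psi0 ?psiS//; exact: WZ.
- move=> i j; have [k|] := unliftP ord0 i => ->; have [l|] := unliftP ord0 j => ->.
  + by rewrite !psiS ophi (inj_eq lift_inj).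
  + by rewrite psi0 psiS BC BZ rphi mulr0 eq_sym (negbTE (neq_lift _ _)).
  + by rewrite psi0 psiS BZ rphi mulr0 (negbTE (neq_lift _ _)).
  + by rewrite psi0 BZ BC BZ mulrA aa eqxx.
have lift_comb u : combination phi u -> combination psi u.
  move=> [c ->]; exists (fun i => if unlift ord0 i is Some k then c k else 0).
  rewrite big_ord_recl unlift_none scale0r add0r; apply: eq_bigr => k _.
  by rewrite liftK psiS.
move=> u; rewrite inE => /predU1P[->|/sphi/lift_comb//].
exists (fun i => if unlift ord0 i is Some k then B v (phi k) else a^-1).
rewrite big_ord_recl unlift_none psi0 scalerA mulVf// scale1r.
rewrite (eq_bigr (fun k => B v (phi k) *: phi k)) ?subrK// => k _.
by rewrite liftK psiS.
Qed.

End gram_schmidt.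

Section christoffel_bounds.
Context {R : realType} {d : nat}.
Local Notation leb_ := (lebesgue_tuple R).
Variable D : set (d.-tuple R).
Hypothesis mD : measurable D.
Hypothesis Dfin : (leb_ d D < +oo)%E.
Variable M : R.
Hypothesis DM : forall x, D x -> forall i, `|tnth x i| <= M.

Lemma peval_bounded (p : {mpoly R[d]}) : [bounded peval p x | x in D].
Proof.
pose K : R := \sum_(m <- msupp p) `|p@_m| * \prod_(i < d) `|M| ^+ m i.
exists K; split; first exact: num_real.
move=> K' KK' x Dx; apply: le_trans (ltW KK').
rewrite /peval mevalE /K (le_trans (ler_norm_sum _ _ _))//.
apply: ler_sum => m _; rewrite normrM ler_wpM2l// normr_prod.
apply: ler_prod => i _; rewrite normr_ge0/= normrX lerXn2r ?nnegrE//.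
by rewrite (le_trans (DM Dx i))// ler_norm.
Qed.

Lemma integrable_peval (p : {mpoly R[d]}) :
  (leb_ d).-integrable D (EFin \o peval p).
Proof.
apply: measurable_bounded_integrable => //; last exact: peval_bounded.
by apply: measurable_funTS; exact: measurable_peval.
Qed.

Definition pint (p : {mpoly R[d]}) : R := \int[leb_ d]_(x in D) peval p x.

Lemma pevalM (p q : {mpoly R[d]}) x : peval (p * q) x = peval p x * peval q x.
Proof. exact: mevalM. Qed.

Lemma pevalD (p q : {mpoly R[d]}) x : peval (p + q) x = peval p x + peval q x.
Proof. exact: mevalD. Qed.

Lemma pevalZ a (p : {mpoly R[d]}) x : peval (a *: p) x = a * peval p x.
Proof. exact: mevalZ. Qed.

Lemma dotL2E p q : dotL2 D p q = pint (p * q).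
Proof. by apply: eq_Rintegral => x _; rewrite pevalM. Qed.

Lemma EFin_pint p : (pint p)%:E = (\int[leb_ d]_(x in D) (peval p x)%:E)%E.
Proof.
rewrite /pint /Rintegral fineK//; apply: integrable_fin_num => //.
exact: integrable_peval.
Qed.

Lemma pintD p q : pint (p + q) = pint p + pint q.
Proof.
rewrite /pint -RintegralD//; try exact: integrable_peval.
by apply: eq_Rintegral => x _; rewrite pevalD.
Qed.

Lemma pintZ a p : pint (a *: p) = a * pint p.
Proof.
rewrite /pint -RintegralZl//; try exact: integrable_peval.
by apply: eq_Rintegral => x _; rewrite pevalZ.
Qed.

Lemma dotL2C p q : dotL2 D p q = dotL2 D q p.
Proof. by rewrite !dotL2E mulrC. Qed.

Lemma dotL2Dl p q r : dotL2 D (p + q) r = dotL2 D p r + dotL2 D q r.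
Proof. by rewrite !dotL2E mulrDl pintD. Qed.

Lemma dotL2Zl a p q : dotL2 D (a *: p) q = a * dotL2 D p q.
Proof. by rewrite !dotL2E -scalerAl pintZ. Qed.

Lemma dotL2_ge0 p : 0 <= dotL2 D p p.
Proof. by apply: Rintegral_ge0 => x _; rewrite -expr2 sqr_ge0. Qed.

Lemma EFin_dotL2 p : (dotL2 D p p)%:E = (\int[leb_ d]_(x in D) (peval p x ^+ 2)%:E)%E.
Proof.
by rewrite dotL2E EFin_pint; apply: eq_integral => x _; rewrite pevalM expr2.
Qed.

Lemma peval_sum N (c : 'I_N -> R) (phi : 'I_N -> {mpoly R[d]}) x :
  peval (\sum_k c k *: phi k) x = \sum_k c k * peval (phi k) x.
Proof.
rewrite /peval raddf_sum/=; apply: eq_bigr => k _; exact: mevalZ.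
Qed.

Lemma dotL2_combination N (phi : 'I_N -> {mpoly R[d]}) c :
  is_orthonormal D phi ->
  dotL2 D (\sum_k c k *: phi k) (\sum_k c k *: phi k) = \sum_k c k ^+ 2.
Proof.
move=> ophi; rewrite (form_sumr dotL2Dl dotL2Zl); apply: eq_bigr => k _.
by rewrite dotL2Zl dotL2C (form_combination dotL2Dl dotL2Zl)// expr2.
Qed.

(** Tested on the reproducing kernel p = sum phi_k(x) phi_k, for which both p(x)
    and the square of the L2 norm equal the Christoffel function at x. When no
    orthonormal basis exists, [christoffel] is 0. *)
Lemma christoffel_le n (K : R) (x : d.-tuple R) : 0 <= K ->
  (forall p, (msize p <= n.+1)%N -> peval p x ^+ 2 <= K * dotL2 D p p) ->
  christoffel n D x <= K.
Proof.
move=> K0 hK; rewrite /christoffel.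
case: xgetP => [c -> [N [phi [[Vphi _] ophi ->]]]|//].
pose c' k := peval (phi k) x; pose p := \sum_k c' k *: phi k.
have pn : (msize p <= n.+1)%N.
  apply: msize_sum_le => k _; rewrite (leq_trans (msizeZ_le _ _))//.
  exact: Vphi.
have := hK p pn; rewrite dotL2_combination// peval_sum.
have -> : \sum_k c' k * peval (phi k) x = \sum_k c' k ^+ 2.
  by apply: eq_bigr => k _; rewrite expr2.
rewrite -/(\sum_k c' k ^+ 2); set s := \sum_k _; have [->//|s0] := eqVneq s 0.
have {}s0 : 0 < s.
  by rewrite lt_neqAle eq_sym s0 sumr_ge0// => k _; exact: sqr_ge0.
by rewrite expr2 ler_pM2r.
Qed.

Lemma poly_space_orthonormal_basis n :
  (forall p : {mpoly R[d]}, (msize p <= n.+1)%N -> p != 0 -> 0 < dotL2 D p p) ->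
  exists N (phi : 'I_N -> {mpoly R[d]}),
    is_basis (poly_space n) phi /\ is_orthonormal D phi.
Proof.
move=> pos.
pose s : seq {mpoly R[d]} := [seq 'X_[bmnm m] | m : 'X_{1..d < n.+1}].
have [||||||u||N [phi [Wphi ophi sphi]]] :=
  @gram_schmidt R _ (dotL2 D) (fun p => (msize p <= n.+1)%N) _ _ _ _ _ _ _ s.
- exact: dotL2C.
- exact: dotL2Dl.
- exact: dotL2Zl.
- exact: pos.
- by rewrite msize0.
- by move=> p q hp hq; rewrite (leq_trans (msizeD_le _ _))// geq_max hp hq.
- by move=> p hp; rewrite (leq_trans (msizeZ_le _ _)).
- by move=> p /mapP[m _ ->]; rewrite msizeX bmdeg.
exists N, phi; split=> //; split=> [//|p pn].
have [c pc] : combination phi p.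
  rewrite (mpolywE pn).
  have hX (m : 'X_{1..d < n.+1}) : combination phi 'X_[m].
    by apply: sphi; apply/mapP; exists m => //; rewrite mem_enum.
  have [c hc] := choice hX.
  exists (fun k => \sum_(m : 'X_{1..d < n.+1}) p@_m * c m k).
  under eq_bigr do rewrite hc scaler_sumr.
  rewrite exchange_big; apply: eq_bigr => k _; rewrite scaler_suml.
  by apply: eq_bigr => m _; rewrite scalerA.
exists c; split=> // c' pc'; apply/funext => k.
rewrite -(form_combination dotL2Dl dotL2Zl c k ophi) -pc pc'.
by rewrite (form_combination dotL2Dl dotL2Zl).
Qed.

(** Cauchy-Schwarz for the expansion of p in the orthonormal basis. Definiteness
    of the form guarantees that [christoffel] is given by a basis and is not the
    default value. *)
Lemma christoffel_ge n (x : d.-tuple R) p :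
  (forall p : {mpoly R[d]}, (msize p <= n.+1)%N -> p != 0 -> 0 < dotL2 D p p) ->
  (msize p <= n.+1)%N -> peval p x ^+ 2 <= dotL2 D p p * christoffel n D x.
Proof.
move=> pos pn; rewrite /christoffel.
have [N [phi [bphi ophi]]] := poly_space_orthonormal_basis pos.
case: xgetP => [c -> [N' [psi [bpsi opsi ->]]]|]; last first.
  by move/(_ (\sum_k peval (phi k) x ^+ 2)) => /=; case; exists N, phi.
have [c' [-> _]] := bpsi.2 _ pn.
rewrite dotL2_combination// peval_sum; exact: sum_mul_sqr_le.
Qed.

End christoffel_bounds.

(** * Norms of polynomials and the two asymptotic equivalences *)

Section nikolskii_bounds.
Context {R : realType} {d : nat}.
Local Notation leb_ := (lebesgue_tuple R).
Variable D : set (d.-tuple R).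
Hypothesis mD : measurable D.
Hypothesis Dfin : (leb_ d D < +oo)%E.
Variable M : R.
Hypothesis DM : forall x, D x -> forall i, `|tnth x i| <= M.
Implicit Types p q : {mpoly R[d]}.

Lemma lebesgue_tuple_setT_gt0 : (0 < leb_ d setT)%E.
Proof.
pose A (i : 'I_d) : set R := `[0%R, 1%R]%classic.
have mA i : measurable (A i) by exact: measurable_itv.
apply: (@lt_le_trans _ _ (leb_ d [set x | forall i, A i (tnth x i)])).
  rewrite lebesgue_tuple_box// big1 ?lte01// => i _.
  by rewrite lebesgue_measure_itv/= lte_fin ltr01 oppr0 adde0.
by apply: le_measure; rewrite ?inE//; exact: measurable_box.
Qed.

Lemma normLp2E p : normLp D 2%:E p = (Num.sqrt (dotL2 D p p))%:E.
Proof.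
rewrite /normLp unlock.
have -> : (\int[leb_ d]_x (`|((fun x => (peval p x)%:E) \_ D) x| `^ 2))%E =
   (dotL2 D p p)%:E.
  rewrite (EFin_dotL2 mD Dfin DM) [RHS]integral_mkcond; apply: eq_integral => x _.
  rewrite !patchE; case: ifP => _; last by rewrite abse0 poweR0r// pnatr_eq0.
  by rewrite abse_EFin poweR_EFin powR_mulrn// real_normK// num_real.
by rewrite poweR_EFin powR12_sqrt// dotL2_ge0.
Qed.

Lemma normLp_oo_le p K : 0 <= K -> (forall x, D x -> `|peval p x| <= K) ->
  (normLp D +oo p <= K%:E)%E.
Proof.
move=> K0 pK; rewrite /normLp unlock lebesgue_tuple_setT_gt0.
apply/ess_supP/aeW => x /=; rewrite patchE; case: ifPn => Dx.
  by rewrite lee_fin pK// -inE.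
by rewrite abse0 lee_fin.
Qed.

Lemma normLp_oo_ge0 p : (0 <= normLp D +oo p)%E.
Proof. exact: Lnorm_ge0. Qed.

(** The sup norm, being an essential supremum, is only known to bound p almost
    everywhere; this is enough to bound integrals. *)
Lemma dotL2_sqr_le p m : normLp D +oo p = m%:E ->
  dotL2 D (p * p) (p * p) <= m ^+ 2 * dotL2 D p p.
Proof.
move=> pm; have m0 : 0 <= m by rewrite -lee_fin -pm normLp_oo_ge0.
have mp q : measurable_fun D (fun x => (peval q x ^+ 2)%:E).
  apply/measurable_EFinP; apply: measurable_funX; apply: measurable_funTS.
  exact: measurable_peval.
rewrite -lee_fin EFinM !(EFin_dotL2 mD Dfin DM).
rewrite -ge0_integralZl//; last 2 first.
- by move=> x _; rewrite lee_fin sqr_ge0.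
- by rewrite lee_fin sqr_ge0.
apply: ae_ge0_le_integral => //.
- by move=> x _; rewrite lee_fin sqr_ge0.
- by move=> x _; rewrite -EFinM lee_fin mulr_ge0 ?sqr_ge0.
- exact: measurable_funeM.
move: pm; rewrite /normLp unlock lebesgue_tuple_setT_gt0 => pm.
have := ess_sup_ge (leb_ d) (abse \o (fun x => (peval p x)%:E) \_ D).
rewrite pm; apply: filterS => x /=; rewrite patchE => + Dx.
rewrite mem_set// abse_EFin lee_fin => px.
rewrite -EFinM lee_fin pevalM exprMn ler_wpM2r ?sqr_ge0//.
by rewrite -(real_normK (num_real _)) lerXn2r ?nnegrE.
Qed.

End nikolskii_bounds.

Section asymptotics.
Context {R : realType} {d : nat}.
Local Notation leb_ := (lebesgue_tuple R).

(** The upper bound holds at every point of D for every polynomial, the lower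
    bound is a single polynomial peaking at a single point. To see that the
    essential supremum m of that polynomial is not much smaller than its value 1
    at x, the upper bound is applied to its square, of degree 2n: it gives
    1 <= C (2n)^sigma m^2 (int p^2), where int p^2 <= C n^-sigma. *)
Lemma asymp_of_bounds (D : set (d.-tuple R)) (M sigma C : R) :
  measurable D -> (leb_ d D < +oo)%E ->
  (forall x, D x -> forall i, `|tnth x i| <= M) ->
  (forall p : {mpoly R[d]}, (forall x, D x -> peval p x = 0) -> p = 0) ->
  0 < C ->
  (forall n (p : {mpoly R[d]}) x, (0 < n)%N -> (msize p <= n.+1)%N -> D x ->
     peval p x ^+ 2 <= C * n%:R `^ sigma * dotL2 D p p) ->
  (forall n, (0 < n)%N -> exists (p : {mpoly R[d]}) x,
     [/\ (msize p <= n.+1)%N, D x, peval p x = 1 &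
         dotL2 D p p <= C * n%:R `^ (- sigma)]) ->
  asymp_equiv (fun n => christoffel_sup n D) (fun n => (n%:R `^ sigma)%:E) /\
  asymp_equiv (fun n => nikolskii_sup n D) (fun n => (n%:R `^ (sigma / 2))%:E).
Proof.
move=> mD Dfin DM D0 C0 up lo.
have pos n (p : {mpoly R[d]}) : (0 < n)%N -> (msize p <= n.+1)%N -> p != 0 ->
    0 < dotL2 D p p.
  move=> n0 pn p0; rewrite lt_neqAle dotL2_ge0 andbT eq_sym.
  apply: contra_neq p0 => pp0; apply: D0 => x Dx.
  have := up n p x n0 pn Dx; rewrite pp0 mulr0 => h.
  by apply/eqP; rewrite -sqrf_eq0 eq_le h sqr_ge0.
split.
  exists C => // n n0; have N0 : 0 < n%:R `^ sigma :> R.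
    by rewrite powR_gt0 ?ltr0n.
  apply/andP; split; last first.
    apply: ge_ereal_sup => _ [x Dx <-]; rewrite lee_fin.
    apply: (christoffel_le mD Dfin DM) => [|p pn]; last exact: up.
    by rewrite mulr_ge0 ?powR_ge0// ltW.
  have [p [x [pn Dx px pp]]] := lo n n0.
  have := christoffel_ge mD Dfin DM x (fun q => pos n q n0) pn.
  rewrite px expr1n => h.
  apply: (@le_trans _ _ (christoffel n D x)%:E); last first.
    by apply: ereal_sup_ubound; exists x.
  rewrite -EFinM lee_fin; set ch := christoffel _ _ _ in h *.
  have pp0 := dotL2_ge0 D p.
  have ch0 : 0 <= ch by nra.
  rewrite mulrC ler_pdivrMr//.
  have {}h : 1 <= C * n%:R `^ (- sigma) * ch by apply: (le_trans h); exact: ler_wpM2r.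
  by move: h; rewrite powRN mulrAC ler_pdivlMr// mul1r [C * ch]mulrC.
pose c := Num.sqrt C + Num.sqrt (C ^+ 3 * 2 `^ sigma).
have sC : 0 < Num.sqrt C by rewrite sqrtr_gt0.
have sC3 : 0 < Num.sqrt (C ^+ 3 * 2 `^ sigma).
  by rewrite sqrtr_gt0 mulr_gt0 ?exprn_gt0 ?powR_gt0.
exists c => [|n n0]; first by rewrite addr_gt0.
have nR : 0 < n%:R :> R by rewrite ltr0n.
have N0 : 0 < n%:R `^ sigma :> R by rewrite powR_gt0.
set S := n%:R `^ (sigma / 2).
have S0 : 0 < S by rewrite powR_gt0.
have SS : n%:R `^ sigma = S ^+ 2.
  by rewrite /S expr2 -powRD -?splitr// (gt_eqF nR) implybT.
have oo_le (p : {mpoly R[d]}) : (msize p <= n.+1)%N ->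
    (normLp D +oo p <= (Num.sqrt C * S * Num.sqrt (dotL2 D p p))%:E)%E.
  move=> pn; apply: normLp_oo_le => [|x Dx].
    by rewrite !mulr_ge0 ?sqrtr_ge0// ltW.
  rewrite -sqrtr_sqr -(gtr0_norm S0) -sqrtr_sqr -!sqrtrM ?(ltW C0)//.
    by rewrite ler_wsqrtr// -SS; exact: up.
  by rewrite mulr_ge0 ?sqr_ge0// ltW.
apply/andP; split; last first.
  apply: ge_ereal_sup => _ [p [pn p0] <-].
  have pp := pos n p n0 pn p0.
  have s0 : 0 < Num.sqrt (dotL2 D p p) by rewrite sqrtr_gt0.
  rewrite (normLp2E mD Dfin DM) inver gt_eqF//.
  apply: (@le_trans _ _ ((Num.sqrt C * S * Num.sqrt (dotL2 D p p))%:E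
      * ((Num.sqrt (dotL2 D p p))^-1)%:E)%E).
    by apply: lee_wpmul2r; [rewrite lee_fin invr_ge0 ltW|exact: oo_le].
  rewrite -!EFinM lee_fin mulfK ?gt_eqF//.
  by rewrite ler_pM2r// /c lerDl ltW.
have [p [x [pn Dx px pp]]] := lo n n0.
have p0 : p != 0.
  apply/eqP => p0; move: px; rewrite p0 /peval meval0 => /eqP.
  by rewrite eq_sym oner_eq0.
have dp := pos n p n0 pn p0.
have s0 : 0 < Num.sqrt (dotL2 D p p) by rewrite sqrtr_gt0.
apply: (@le_trans _ _ (normLp D +oo p / normLp D 2%:E p)%E); last first.
  by apply: ereal_sup_ubound; exists p.
have [m pm] : exists m, normLp D +oo p = m%:E.
  have := oo_le p pn; have := normLp_oo_ge0 D p.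
  by case: (normLp D +oo p) => [m| |]//; exists m.
have m0 : 0 <= m by rewrite -lee_fin -pm normLp_oo_ge0.
rewrite pm (normLp2E mD Dfin DM) inver gt_eqF// -!EFinM lee_fin.
have n2 : (0 < 2 * n)%N by rewrite muln_gt0.
have ppn : (msize (p * p) <= (2 * n).+1)%N by rewrite mul2n -addnn; exact: msize_mul_le.
have := up (2 * n)%N (p * p) x n2 ppn Dx.
rewrite pevalM px mulr1 expr1n natrM powRM// SS => h.
have h2 := dotL2_sqr_le mD Dfin DM pm.
move: pp; rewrite powRN SS => pp.
rewrite ler_pdivlMr//.
have key : S ^+ 2 * dotL2 D p p <= C ^+ 3 * 2 `^ sigma * m ^+ 2.
  have P2 : 0 < 2 `^ sigma :> R by rewrite powR_gt0.
  have pS : dotL2 D p p * S ^+ 2 <= C.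
    by rewrite -ler_pdivlMr// exprn_gt0.
  move: h h2 pS; set X := dotL2 D (p * p) (p * p); set Y := dotL2 D p p in dp *.
  move: (2 `^ sigma) P2 => P P2 h h2 pS.
  have h3 : 1 <= C * (P * S ^+ 2) * (m ^+ 2 * Y).
    apply: (le_trans h); apply: ler_wpM2l => //.
    by rewrite !mulr_ge0 ?sqr_ge0// ltW.
  have h4 : 1 <= C * P * m ^+ 2 * (Y * S ^+ 2).
    by apply: (le_trans h3); rewrite le_eqVlt; apply/orP; left; apply/eqP; ring.
  have m2 : 0 <= C * P * m ^+ 2 by rewrite !mulr_ge0 ?sqr_ge0// ltW.
  have h5 : 1 <= C * P * m ^+ 2 * C.
    by apply: (le_trans h4); exact: ler_wpM2l.
  apply: (@le_trans _ _ (C * (C * P * m ^+ 2 * C))); last first.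
    by rewrite le_eqVlt; apply/orP; left; apply/eqP; ring.
  by rewrite mulrC (le_trans pS)// ler_peMr// ltW.
have : S * Num.sqrt (dotL2 D p p) <= Num.sqrt (C ^+ 3 * 2 `^ sigma) * m.
  rewrite -(gtr0_norm S0) -sqrtr_sqr -(ger0_norm m0) -(sqrtr_sqr m) -!sqrtrM ?sqr_ge0//.
    exact: ler_wsqrtr.
  by rewrite mulr_ge0 ?powR_ge0// exprn_ge0// ltW.
move=> h3; rewrite -mulrA ler_pdivrMl ?addr_gt0//.
by apply: (le_trans h3); apply: ler_wpM2r => //; rewrite lerDr ltW.
Qed.

End asymptotics.

(** * From the shape of a body to the exponent *)

Section reductions.
Context {R : realType} {d : nat}.
Local Notation leb_ := (lebesgue_tuple R).
Variables (D : set (d.+1.-tuple R)) (M : R).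
Hypothesis mD : measurable D.
Hypothesis Dfin : (leb_ d.+1 D < +oo)%E.
Hypothesis DM : forall x, D x -> forall i, `|tnth x i| <= M.

(** Every point of D is the tip of a cusp contained in D, in which the depth is
    t = x^2 up to the factor s, and the width at depth t is t^gamma, with constants
    that are uniform over D. *)
Definition has_cusps (gamma : R) := exists t0 lam : R, [/\ 0 < t0, 0 < lam &
  forall x0, D x0 -> exists (j : 'I_d.+1) (s : R) (a g : 'I_d -> R), `|s| = t0 /\
    forall (x : R) (z : 'I_d -> R), `|x| <= 1 ->
      (forall i, `|z i| <= lam * `|x| `^ (2 * gamma)) ->
      D (ins j (tnth x0 j + s * x ^+ 2 - \sum_i g i * (a i * x ^+ 2 + z i))
           [tuple tnth x0 (lift j i) + (a i * x ^+ 2 + z i) | i < d])].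

(** Where |x| >= 1/(24n), the cusp of width |x|^(2 gamma) contains the parabolic
    cusp of width b |x|, with b comparable to n^(1 - 2 gamma). The exponent of n
    in [christoffel_cusp], for the dimension d + 1, is then
    d + 2 + (2 gamma - 1) d = 2 + 2 gamma d. *)
Lemma upper_of_cusps gamma : 1 / 2 <= gamma -> has_cusps gamma ->
  exists2 C : R, 0 < C & forall n (p : {mpoly R[d.+1]}) x,
    (0 < n)%N -> (msize p <= n.+1)%N -> D x ->
    peval p x ^+ 2 <= C * n%:R `^ (2 + 2 * gamma * d%:R) * dotL2 D p p.
Proof.
move=> g2 [t0 [lam [t00 lam0 cusps]]].
pose K : R := 24 `^ ((1 - 2 * gamma) * d%:R).
have K0 : 0 < K by rewrite powR_gt0.
have l0 : 0 < lam ^+ d by rewrite exprn_gt0.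
have P0 : 0 < 2 * 12 ^+ d.+1 * 2 ^+ d.+2 :> R.
  by apply: mulr_gt0; [apply: mulr_gt0 => //|]; exact: exprn_gt0.
exists (2 * (2 * 12 ^+ d.+1 * 2 ^+ d.+2) / (t0 * lam ^+ d * K)).
  by rewrite divr_gt0// ?mulr_gt0.
move=> n p x n0 pn Dx.
have [j [s [a [g [st0 hD]]]]] := cusps x Dx.
have nR : 1 <= n%:R :> R by rewrite ler1n.
have n24 : 0 < 24 * n%:R :> R by lra.
pose b := lam * (24 * n%:R) `^ (1 - 2 * gamma).
have b0 : 0 < b by rewrite mulr_gt0// powR_gt0.
have s0 : s != 0 by rewrite -normr_eq0 st0 gt_eqF.
have cuspD y (u : d.-tuple R) : (24 * n%:R)^-1 <= `|y| <= 1 ->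
    (forall i, 0 <= tnth u i <= 1) -> D (cusp x j s b a g y u).
  move=> /andP[y0 y1] u01; apply: hD => // i.
  rewrite normrM normrM (gtr0_norm b0) /b -!mulrA ler_wpM2l ?(ltW lam0)//.
  apply: (@le_trans _ _ ((24 * n%:R) `^ (1 - 2 * gamma) * `|y|)).
    apply: ler_wpM2l; first exact: powR_ge0.
    have /andP[u0 u1] := u01 i.
    by rewrite (ger0_norm u0) ler_piMr.
  have yp : 0 < `|y| by apply: lt_le_trans y0; rewrite invr_gt0.
  have -> : `|y| `^ (2 * gamma) = `|y| `^ (2 * gamma - 1) * `|y|.
    by rewrite -{3}(powRr1 (ltW yp)) -powRD ?subrK// (gt_eqF yp) implybT.
  apply: ler_wpM2r => //.
  have -> : 1 - 2 * gamma = -1 * (2 * gamma - 1) by ring.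
  rewrite -powR_inv1 ?(ltW n24)// in y0.
  rewrite powRrM; apply: ge0_ler_powR => //; last by rewrite nnegrE powR_ge0.
  lra.
have := christoffel_cusp mD n0 pn s0 b0 cuspD.
rewrite -(EFin_dotL2 mD Dfin DM) -EFinM lee_fin st0 => H.
have bE : b ^+ d = lam ^+ d * (K * n%:R `^ ((1 - 2 * gamma) * d%:R)).
  rewrite /b exprMn; congr (_ * _).
  by rewrite -powR_mulrn ?powR_ge0// -powRrM powRM//; lra.
have nE : n%:R `^ (2 + 2 * gamma * d%:R) =
    n%:R ^+ d.+2 / n%:R `^ ((1 - 2 * gamma) * d%:R) :> R.
  rewrite -powR_mulrn// -powRN -powRD; last first.
    by apply/implyP => _; rewrite gt_eqF//; lra.
  by congr (_ `^ _); rewrite -!(addn1 d.+1) -(addn1 d) !natrD; ring.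
move: H; rewrite bE nE natrM exprMn.
have Y0 : 0 < n%:R `^ ((1 - 2 * gamma) * d%:R) :> R by rewrite powR_gt0//; lra.
have X0 : 0 < n%:R ^+ d.+2 :> R by rewrite exprn_gt0//; lra.
move: (n%:R `^ ((1 - 2 * gamma) * d%:R)) Y0 (n%:R ^+ d.+2) X0 => Y Y0 X X0.
move: (peval p x ^+ 2) (dotL2 D p p) => q I.
move: (12 ^+ d.+1) (2 ^+ d.+2) P0 (lam ^+ d) l0 => A B P0 L l0 H.
have -> : 2 * (2 * A * B) / (t0 * L * K) * (X / Y) * I =
   (2 * I) * (2 * A * (B * X)) / (t0 * (L * (K * Y))).
  by field; rewrite !gt_eqF.
rewrite ler_pdivlMr ?mulr_gt0//.
rewrite -ler_pdivrMr; last by rewrite !mulrA mulr_gt0.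
by rewrite mulrAC mulrC.
Qed.

(** If D touches the hyperplane of depth 0 at x0 with width at most t^gamma at
    depth t, a ridge polynomial of degree n peaking at depth 0 has its mass on a
    cell of volume n^-2 times n^(-2 gamma d). *)
Lemma lower_of_contact gamma (x0 : d.+1.-tuple R) v (C T : R) :
  0 <= gamma -> 0 <= C -> 0 < T -> D x0 ->
  (forall x, D x -> 0 <= depth x0 v x <= T /\
     forall i, `|tnth x (lift ord0 i) - tnth x0 (lift ord0 i)| <=
        C * depth x0 v x `^ gamma) ->
  exists2 C' : R, 0 < C' & forall n, (0 < n)%N -> exists (p : {mpoly R[d.+1]}) x,
     [/\ (msize p <= n.+1)%N, D x, peval p x = 1 &
         dotL2 D p p <= C' * n%:R `^ (- (2 + 2 * gamma * d%:R))].
Proof.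
move=> g0 C0 T0 Dx0 DC.
have beta0 : 0 <= gamma * d%:R by rewrite mulr_ge0.
have [C' C'0 peak] := peak_poly T0 beta0.
have K0 : 0 <= (2 * C) ^+ d by rewrite exprn_ge0// mulr_ge0.
exists ((2 * C) ^+ d * C' + 1) => [|n n0]; first by rewrite ltr_wpDl// mulr_ge0// ltW.
have [q [qn q0 qI]] := peak n n0.
exists (ridge x0 v q), x0; split => //.
- exact: msize_ridge.
- rewrite peval_ridge /depth subrr add0r big1 ?q0// => i _.
  by rewrite subrr mulr0.
rewrite -lee_fin (EFin_dotL2 mD Dfin DM).
apply: (le_trans (ridge_integral_le q mD C0 DC)).
apply: (le_trans (lee_wpmul2l _ qI)); first by rewrite lee_fin.
have -> : 2 * (gamma * d%:R) + 2 = 2 + 2 * gamma * d%:R by ring.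
set N := n%:R `^ _; have N0 : 0 <= N by exact: powR_ge0.
by rewrite -EFinM lee_fin [in leRHS]mulrDl mul1r mulrA lerDl.
Qed.

End reductions.

(** * Polynomials vanishing on a box *)

Section vanishing.
Context {R : realType}.

Lemma radix_inj d N (f g : 'I_d -> nat) :
  (forall i, f i < N)%N -> (forall i, g i < N)%N ->
  (\sum_i f i * N ^ i = \sum_i g i * N ^ i)%N -> f =1 g.
Proof.
elim: d f g => [|d IH] f g fN gN; first by move=> _ [].
rewrite !big_ord_recl !expn0 !muln1.
have e (h : 'I_d.+1 -> nat) : (\sum_(i < d) h (lift ord0 i) * N ^ (lift ord0 i) =
    (\sum_(i < d) h (lift ord0 i) * N ^ i) * N)%N.
  by rewrite big_distrl; apply: eq_bigr => i _; rewrite lift0 expnSr mulnA.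
rewrite !e => fg.
have fg0 : f ord0 = g ord0.
  have := congr1 (modn^~ N) fg; rewrite ![(_ ord0 + _)%N]addnC !modnMDl.
  by rewrite !modn_small.
have fgS : (fun i => f (lift ord0 i)) =1 (fun i => g (lift ord0 i)).
  apply: IH => [i|i|]; rewrite ?fN ?gN//.
  move: fg; rewrite fg0 => /addnI/eqP; rewrite eqn_pmul2r; first by move/eqP.
  exact: leq_ltn_trans (fN ord0).
by move=> i; have [k|] := unliftP ord0 i => ->.
Qed.

Lemma poly_eq0_interval (P : {poly R}) (r : R) : 0 < r ->
  (forall t, 0 < t <= r -> P.[t] = 0) -> P = 0.
Proof.
move=> r0 P0; apply: contraTeq isT => Pn0.
pose s := [seq r / k.+1%:R | k <- iota 0 (size P)].
have us : uniq s.
  rewrite map_inj_uniq ?iota_uniq// => k l /(mulfI (lt0r_neq0 r0))/invr_inj/eqP.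
  by rewrite eqr_nat => /eqP[].
have rs : all (root P) s.
  apply/allP => _ /mapP[k _ ->]; apply/eqP/P0.
  by rewrite divr_gt0//= ler_pdivrMr// ler_peMr ?ler1n// ltW.
by have := max_poly_roots Pn0 rs us; rewrite size_map size_iota ltnn.
Qed.

(** Kronecker's substitution X_i |-> X^(N^i) with N the size of p maps the
    monomials of p to distinct powers. The curve t |-> (t^(N^i))_i stays in the
    box for small positive t, so the resulting polynomial has infinitely many
    roots. *)
Lemma mpoly_eq0_box d (p : {mpoly R[d]}) (r : R) : 0 < r ->
  (forall x, (forall i, `|tnth x i| <= r) -> peval p x = 0) -> p = 0.
Proof.
move=> r0 p0; pose N := (msize p).
have [//|pn0] := eqVneq p 0.
have N0 : (0 < N)%N by rewrite lt0n mmeasure_poly_eq0.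
pose P := poly_curve p (fun i : 'I_d => 'X^(N ^ i)).
have P0 : P = 0.
  pose r' := Num.min r 1.
  apply: (@poly_eq0_interval _ r') => [|t /andP[t0]]; first by rewrite lt_min r0 ltr01.
  rewrite le_min => /andP[tr t1].
  rewrite (@horner_poly_curve _ _ p _ _ [tuple t ^+ (N ^ i) | i < d]); last first.
    by move=> i; rewrite tnth_mktuple hornerXn.
  apply: p0 => i; rewrite tnth_mktuple normrX gtr0_norm//; apply: le_trans tr.
  have : (0 < N ^ i)%N by rewrite expn_gt0 N0.
  case: (N ^ i)%N => // k _; rewrite exprS ler_piMr ?(ltW t0)//.
  by rewrite exprn_ile1// ltW.
apply/mpolyP => m; rewrite mcoeff0; have [//|pm] := eqVneq p@_m 0.
have mp : m \in msupp p by rewrite mcoeff_msupp.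
have bnd m' : m' \in msupp p -> forall i, (m' i < N)%N.
  move=> /msize_mdeg_lt h i; apply: leq_ltn_trans h.
  by rewrite mdegE (bigD1 i)//= leq_addr.
have <- : P`_(\sum_i m i * N ^ i) = p@_m.
  rewrite /P /poly_curve coef_sum (bigD1_seq m)//= ?msupp_uniq//.
  have E m' : \prod_(i < d) ('X^(N ^ i) : {poly R}) ^+ m' i =
     'X^(\sum_i m' i * N ^ i).
    by rewrite -prodrXr; apply: eq_bigr => i _; rewrite -exprM mulnC.
  rewrite E coefZ coefXn eqxx mulr1 big_seq_cond big1 ?addr0// => m' /andP[m'p mm'].
  rewrite E coefZ coefXn; case: eqP => [e|_]; last by rewrite mulr0.
  case/eqP: mm'; apply/esym/mnmP; exact: (radix_inj (bnd m mp) (bnd m' m'p)).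
by rewrite P0 coef0.
Qed.

End vanishing.

(** * Taylor bounds for powers *)

Section powers.
Context {R : realType}.
Implicit Types (a b h x y r alpha : R).

(** Young's inequality for the product x * 1. *)
Lemma bernoulli_powR r x : 1 <= r -> 0 <= x -> 1 + r * (x - 1) <= x `^ r.
Proof.
rewrite le_eqVlt => /predU1P[<- x0|r1 x0]; first by rewrite powRr1// mul1r subrKC.
have r0 : 0 < r by lra.
have q0 : 0 < r / (r - 1) by rewrite divr_gt0//; lra.
have pq : r^-1 + (r / (r - 1))^-1 = 1 by field; rewrite !gt_eqF//; lra.
have := conjugate_powR x0 ler01 r0 q0 pq; rewrite powR1 mulr1 => h.
have -> : x `^ r = r * (x `^ r / r) by rewrite mulrCA divff ?mulr1// gt_eqF.
have e : 1 / (r / (r - 1)) = 1 - r^-1 by field; rewrite !gt_eqF//; lra.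
rewrite e in h.
have : r * x <= r * (x `^ r / r + (1 - r^-1)) by apply: ler_wpM2l => //; exact: ltW.
rewrite mulrDr (mulrBr r 1) divff ?gt_eqF//; lra.
Qed.

Lemma powR_tangent_le r x y : 1 <= r -> 0 <= x -> 0 <= y ->
  y `^ r + r * y `^ (r - 1) * (x - y) <= x `^ r.
Proof.
move=> r1 x0; rewrite le_eqVlt => /predU1P[<-|y0].
  rewrite powR0 ?gt_eqF//; last lra.
  move: r1; rewrite le_eqVlt => /predU1P[<-|r1].
    by rewrite subrr powRr0 powRr1// subr0 !mul1r add0r.
  by rewrite powR0 ?mulr0 ?mul0r ?addr0 ?powR_ge0// gt_eqF// subr_gt0.
have xy0 : 0 <= x / y by rewrite divr_ge0// ltW.
have h := bernoulli_powR r1 xy0.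
have -> : x `^ r = y `^ r * (x / y) `^ r.
  by rewrite -powRM// ?(ltW y0)// mulrCA divff ?mulr1// gt_eqF.
have -> : y `^ r + r * y `^ (r - 1) * (x - y) = y `^ r * (1 + r * (x / y - 1)).
  rewrite -(mulr_powRB1 (ltW y0) (lt_le_trans ltr01 r1)).
  by field; rewrite gt_eqF.
by rewrite ler_wpM2l// powR_ge0.
Qed.

(** The concave case is the convex one for the exponent 1/r. *)
Lemma powR_tangent_ge r x y : 0 < r <= 1 -> 0 <= x -> 0 < y ->
  x `^ r <= y `^ r + r * y `^ (r - 1) * (x - y).
Proof.
move=> /andP[r0 r1] x0 y0.
have xy0 : 0 <= x / y by rewrite divr_ge0// ltW.
have rV : 1 <= r^-1 by rewrite invf_ge1.
have := bernoulli_powR rV (powR_ge0 (x / y) r).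
rewrite -powRrM divff ?gt_eqF// powRr1// => h.
have h2 : (x / y) `^ r <= 1 + r * (x / y - 1).
  have -> : (x / y) `^ r = 1 + r * (1 + r^-1 * ((x / y) `^ r - 1) - 1).
    by field; rewrite gt_eqF.
  by rewrite lerD2l ler_pM2l// lerD2r.
have -> : x `^ r = y `^ r * (x / y) `^ r.
  by rewrite -powRM// ?(ltW y0)// mulrCA divff ?mulr1// gt_eqF.
have -> : y `^ r + r * y `^ (r - 1) * (x - y) = y `^ r * (1 + r * (x / y - 1)).
  rewrite -(mulr_powRB1 (ltW y0) r0).
  by field; rewrite gt_eqF.
by rewrite ler_wpM2l// powR_ge0.
Qed.

Lemma norm_powR_sqr b r : `|b| `^ r = (b ^+ 2) `^ (r / 2).
Proof. by rewrite -real_normK ?num_real// -powR_mulrn// -powRrM mulrC divfK. Qed.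

(** Since |b|^alpha = (b^2)^(alpha/2), the power is a convex function of the
    square when alpha >= 2 and a concave one when alpha <= 2. The tangent in the
    variable b^2 has a term in (b - a)^2, which the tangent in b lacks. *)
Lemma norm_powR_convex alpha a b : 2 <= alpha -> a != 0 ->
  `|a| `^ alpha + alpha / 2 * `|a| `^ (alpha - 2) * (b ^+ 2 - a ^+ 2)
  <= `|b| `^ alpha.
Proof.
move=> al2 a0; rewrite !(norm_powR_sqr _ alpha) (norm_powR_sqr a).
have -> : (alpha - 2) / 2 = alpha / 2 - 1 by field.
by apply: powR_tangent_le; rewrite ?sqr_ge0//; lra.
Qed.

Lemma norm_powR_concave alpha a b : 0 < alpha <= 2 -> a != 0 ->
  `|b| `^ alpha <=
  `|a| `^ alpha + alpha / 2 * `|a| `^ (alpha - 2) * (b ^+ 2 - a ^+ 2).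
Proof.
move=> al2 a0; rewrite !(norm_powR_sqr _ alpha) (norm_powR_sqr a).
have -> : (alpha - 2) / 2 = alpha / 2 - 1 by field.
apply: powR_tangent_ge; rewrite ?sqr_ge0//; first lra.
by rewrite exprn_even_gt0.
Qed.

(** The derivative of |.|^alpha; for alpha = 1 and a = 0, where there is none, the
    value 0 is a subgradient. *)
Definition dpow alpha a := alpha * (a * `|a| `^ (alpha - 2)).

Lemma mul_powRB2 alpha x : 0 < alpha -> 0 <= x ->
  x * (x * x `^ (alpha - 2)) = x `^ alpha.
Proof.
move=> al0; rewrite le_eqVlt => /predU1P[<-|x0]; first by rewrite mul0r powR0// gt_eqF.
rewrite -{1 2}(powRr1 (ltW x0)) -!powRD ?(gt_eqF x0) ?implybT//.
by congr (_ `^ _); ring.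
Qed.

(** If |h| <= |a|, the tangent in the square of the variable leaves the remainder
    (alpha/2) |a|^(alpha-2) h^2, which is at most |h|^alpha. Otherwise every term
    is bounded by a multiple of |h|^alpha. *)
Lemma norm_powRD_le2 alpha a h : 1 <= alpha <= 2 ->
  `|a + h| `^ alpha <= `|a| `^ alpha + dpow alpha a * h + 6 * `|h| `^ alpha.
Proof.
move=> /andP[al1 al2]; have al0 : 0 < alpha by lra.
have [->|a0] := eqVneq a 0.
  rewrite /dpow add0r normr0 powR0 ?gt_eqF// mul0r mulr0 mul0r !add0r.
  by rewrite ler_peMl ?powR_ge0//; lra.
have [->|h0] := eqVneq h 0.
  by rewrite addr0 mulr0 addr0 normr0 powR0 ?gt_eqF// mulr0 addr0.
have na0 : 0 < `|a| by rewrite normr_gt0.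
have nh0 : 0 < `|h| by rewrite normr_gt0.
have H0 := powR_ge0 `|h| alpha.
have [ha|ah] := leP `|h| `|a|.
  have al02 : 0 < alpha <= 2 by rewrite al0.
  apply: (le_trans (norm_powR_concave (a + h) al02 a0)).
  have -> : (a + h) ^+ 2 - a ^+ 2 = 2 * a * h + h ^+ 2 by ring.
  have e : `|a| `^ (alpha - 2) * h ^+ 2 <= `|h| `^ alpha.
    rewrite -(mul_powRB2 al0 (ltW nh0)) mulrA -expr2 real_normK ?num_real//.
    rewrite mulrC ler_wpM2l ?sqr_ge0//.
    have -> : alpha - 2 = - (2 - alpha) by ring.
    rewrite !powRN lef_pV2 ?posrE ?powR_gt0//.
    by apply: ge0_ler_powR; rewrite ?nnegrE//; lra.
  rewrite /dpow; move: (`|a| `^ (alpha - 2)) e => p e.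
  have -> : alpha / 2 * p * (2 * a * h + h ^+ 2) =
    alpha * (a * p) * h + alpha / 2 * (p * h ^+ 2) by field.
  rewrite addrA lerD2l.
  apply: (@le_trans _ _ (alpha / 2 * `|h| `^ alpha)); first by rewrite ler_wpM2l//; lra.
  by rewrite ler_wpM2r//; lra.
have h1 : `|a + h| `^ alpha <= 4 * `|h| `^ alpha.
  apply: (@le_trans _ _ ((2 * `|h|) `^ alpha)).
    apply: ge0_ler_powR; rewrite ?nnegrE//; try lra.
    by rewrite (le_trans (ler_normD _ _))//; lra.
  rewrite powRM// ler_wpM2r//.
  have -> : 4 = 2 `^ 2%:R :> R by rewrite powR_mulrn//; ring.
  by apply: ler_powR; lra.
have h2 : `|dpow alpha a * h| <= 2 * `|h| `^ alpha.
  rewrite /dpow !normrM (ger0_norm (powR_ge0 _ _)) (gtr0_norm al0) -mulrA.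
  apply: ler_pM => //; first exact: ltW.
  have e x : 0 < x -> x * x `^ (alpha - 2) = x `^ (alpha - 1).
    move=> x0; rewrite -{1}(powRr1 (ltW x0)) -powRD ?(gt_eqF x0) ?implybT//.
    by congr (_ `^ _); ring.
  rewrite -[leRHS](mul_powRB2 al0 (ltW nh0)) [leRHS]mulrC ler_wpM2r// !e//.
  by apply: ge0_ler_powR; rewrite ?nnegrE//; [lra|exact: ltW].
have h3 := powR_ge0 `|a| alpha.
have := ler_norm (- (dpow alpha a * h)); rewrite normrN; lra.
Qed.

Lemma powR_lipschitz r x y K : 1 <= r -> 0 <= x <= K -> 0 <= y <= K ->
  `|x `^ r - y `^ r| <= r * K `^ (r - 1) * `|x - y|.
Proof.
move=> r1; wlog xy : x y / y <= x.
  move=> H xK yK; have [/H|/ltW/H] := leP y x; first exact.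
  by rewrite distrC [`|y - x|]distrC; apply.
move=> /andP[x0 xK] /andP[y0 yK].
have h := powR_tangent_le r1 y0 x0.
have mono : y `^ r <= x `^ r by apply: ge0_ler_powR; rewrite ?nnegrE//; lra.
rewrite ger0_norm ?subr_ge0// ger0_norm ?subr_ge0//.
apply: (@le_trans _ _ (r * x `^ (r - 1) * (x - y))); first by lra.
rewrite ler_wpM2r ?subr_ge0// ler_wpM2l//; first lra.
by apply: ge0_ler_powR; rewrite ?nnegrE//; lra.
Qed.

(** The tangent in the square of the variable is taken at b = a + h instead of a.
    The resulting error involves a (|b|^s - |a|^s) with s = alpha - 2, a quantity
    of order h because x^(s+1) is Lipschitz, although x^s is not when s < 1. *)
Lemma norm_powRD_ge2 alpha : 2 <= alpha -> exists2 C : R, 0 < C &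
  forall a h, `|a| <= 1 -> `|h| <= 1 ->
  `|a + h| `^ alpha <= `|a| `^ alpha + dpow alpha a * h + C * h ^+ 2.
Proof.
move=> al2; have al0 : 0 < alpha by lra.
pose s := alpha - 2.
pose K : R := 2 `^ s.
have K1 : 1 <= K.
  apply: (@le_trans _ _ (2 `^ 0)); first by rewrite powRr0.
  by apply: ler_powR; rewrite /s; lra.
exists (alpha / 2 * K + alpha * (K + (s + 1) * K)) => [|a h a1 h1].
  have K0 : 0 < K by lra.
  apply: addr_gt0; apply: mulr_gt0 => //; first lra.
  by apply: addr_gt0 => //; apply: mulr_gt0 => //; rewrite /s; lra.
set b := a + h.
have b2 : `|b| <= 2 by rewrite (le_trans (ler_normD _ _))//; lra.
have T : `|b| `^ alpha + alpha / 2 * `|b| `^ s * (a ^+ 2 - b ^+ 2) <= `|a| `^ alpha.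
  rewrite !(norm_powR_sqr _ alpha) (norm_powR_sqr b).
  have -> : s / 2 = alpha / 2 - 1 by rewrite /s; field.
  by apply: powR_tangent_le; rewrite ?sqr_ge0//; lra.
have Bs : `|b| `^ s <= K by apply: ge0_ler_powR; rewrite ?nnegrE//; rewrite /s; lra.
have Bs0 := powR_ge0 `|b| s.
have d1 : `| `|a| - `|b| | <= `|h|.
  by rewrite (le_trans (ler_dist_dist _ _))// /b opprD addNKr normrN.
have d2 : `| `|a| * `|b| `^ s - `|a| * `|a| `^ s| <= (K + (s + 1) * K) * `|h|.
  have e (x : R) : 0 <= x -> x * x `^ s = x `^ (s + 1).
    move=> x0; have := @mulr_powRB1 _ x (s + 1) x0; rewrite addrK; apply.
    by rewrite /s; lra.
  have L := @powR_lipschitz (s + 1) `|b| `|a| 2.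
  have {}L : `| `|b| `^ (s + 1) - `|a| `^ (s + 1)| <= (s + 1) * K * `|h|.
    apply: (le_trans (L _ _ _)); rewrite ?normr_ge0//; try (rewrite /s; lra).
    rewrite addrK distrC ler_wpM2l// mulr_ge0//; rewrite /s; lra.
  have -> : `|a| * `|b| `^ s - `|a| * `|a| `^ s =
     (`|a| - `|b|) * `|b| `^ s + (`|b| `^ (s + 1) - `|a| `^ (s + 1)).
    by rewrite -!e//; ring.
  apply: (le_trans (ler_normD _ _)); rewrite [leRHS]mulrDl; apply: lerD => //.
  by rewrite normrM mulrC (ger0_norm Bs0); apply: ler_pM.
have d3 : (`|b| `^ s - `|a| `^ s) * (a * h) <= (K + (s + 1) * K) * h ^+ 2.
  apply: (le_trans (ler_norm _)); rewrite normrM normrM mulrA.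
  rewrite -(real_normK (num_real h)) expr2 mulrA ler_wpM2r//.
  by apply: le_trans d2; rewrite -mulrBr normrM normr_id mulrC.
rewrite /dpow -/s.
have e2 : a ^+ 2 - b ^+ 2 = - (2 * (a * h) + h ^+ 2) by rewrite /b; ring.
rewrite e2 in T.
have hh := sqr_ge0 h.
have -> : alpha * (a * `|a| `^ s) * h = alpha * (`|a| `^ s * (a * h)) by ring.
move: T d3 Bs Bs0 hh.
move: (`|b| `^ s) (`|a| `^ s) (K + (s + 1) * K) (a * h) (h ^+ 2) => B A k u v.
move: (`|b| `^ alpha) (`|a| `^ alpha) => Ba Aa T d3 BK B0 v0.
have f1 : alpha * ((B - A) * u) <= alpha * (k * v) by rewrite ler_pM2l.
have f2 : alpha / 2 * (B * v) <= alpha / 2 * (K * v).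
  by rewrite ler_wpM2l ?ler_wpM2r//; lra.
have -> : Aa + alpha * (A * u) + (alpha / 2 * K + alpha * k) * v =
   Aa + alpha * (A * u) + (alpha / 2 * (K * v) + alpha * (k * v)) by ring.
have e3 : alpha / 2 * B * - (2 * u + v) =
   - (alpha * ((B - A) * u) + alpha * (A * u) + alpha / 2 * (B * v)) by field.
by rewrite e3 in T; lra.
Qed.

(** Away from 0 the remainder is quadratic also for alpha < 2. *)
Lemma norm_powRD_away alpha kap : 1 <= alpha -> 0 < kap -> exists2 C : R, 0 < C &
  forall a h, kap <= `|a| <= 1 -> `|h| <= 1 ->
  `|a + h| `^ alpha <= `|a| `^ alpha + dpow alpha a * h + C * h ^+ 2.
Proof.
move=> al1 kap0; have [al2|al2] := leP alpha 2; last first.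
  have [C C0 HC] := norm_powRD_ge2 (ltW al2).
  by exists C => // a h /andP[_ a1]; exact: HC.
exists (alpha / 2 * kap `^ (alpha - 2)) => [|a h /andP[a0 a1] _].
  by rewrite mulr_gt0 ?powR_gt0//; lra.
have al02 : 0 < alpha <= 2 by lra.
have na0 : 0 < `|a| by lra.
have an0 : a != 0 by rewrite -normr_gt0.
apply: (le_trans (norm_powR_concave (a + h) al02 an0)).
rewrite /dpow.
have -> : (a + h) ^+ 2 - a ^+ 2 = 2 * a * h + h ^+ 2 by ring.
have e : `|a| `^ (alpha - 2) <= kap `^ (alpha - 2).
  have -> : alpha - 2 = - (2 - alpha) by ring.
  rewrite !powRN lef_pV2 ?posrE ?powR_gt0//.
  by apply: ge0_ler_powR; rewrite ?nnegrE//; lra.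
have hh := sqr_ge0 h.
move: (`|a| `^ (alpha - 2)) (kap `^ (alpha - 2)) e => p q e.
have -> : alpha / 2 * p * (2 * a * h + h ^+ 2) =
    alpha * (a * p) * h + alpha / 2 * p * h ^+ 2 by field.
by rewrite addrA lerD2l ler_wpM2r// ler_wpM2l//; lra.
Qed.

Lemma norm_powRD alpha : 1 <= alpha -> exists2 C : R, 0 < C &
  forall a h, `|a| <= 1 -> `|h| <= 1 ->
  `|a + h| `^ alpha <= `|a| `^ alpha + dpow alpha a * h
     + C * `|h| `^ (Num.min alpha 2).
Proof.
move=> al1; have [al2|al2] := leP alpha 2.
  exists 6 => // a h _ _; apply: norm_powRD_le2; lra.
have [C C0 HC] := norm_powRD_ge2 (ltW al2); exists C => // a h a1 h1.
apply: (le_trans (HC _ _ a1 h1)).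
by rewrite powR_mulrn// real_normK// num_real.
Qed.

End powers.

(** * Cusps contained in the balls *)

Section lp_balls.
Context {R : realType}.
Local Notation leb_ := (lebesgue_tuple R).

Lemma powR_le1 (x r : R) : 0 <= x <= 1 -> 0 <= r -> x `^ r <= 1.
Proof.
move=> /andP[x0 x1] r0; apply: (@le_trans _ _ (1 `^ r)); last by rewrite powR1.
by apply: ge0_ler_powR; rewrite ?nnegrE.
Qed.

Lemma lp_ballP d (alpha : R) (x : d.-tuple R) : 1 <= alpha ->
  lp_ball d alpha%:E x <-> \sum_(i < d) `|tnth x i| `^ alpha <= 1.
Proof.
move=> al1; rewrite /lp_ball/=; set S := \sum_(i < d) _.
have S0 : 0 <= S by apply: sumr_ge0 => i _; exact: powR_ge0.
have aV : 0 <= alpha^-1 by rewrite invr_ge0; lra.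
split=> [h|h].
  have -> : S = (S `^ alpha^-1) `^ alpha.
    by rewrite -powRrM mulVf ?powRr1// gt_eqF//; lra.
  by apply: powR_le1; [rewrite powR_ge0|lra].
by apply: powR_le1 => //; rewrite S0.
Qed.

Lemma lp_ball_le1 d (alpha : \bar R) (x : d.-tuple R) i : (1 <= alpha)%E ->
  lp_ball d alpha x -> `|tnth x i| <= 1.
Proof.
case: alpha => [alpha| |]//; last by move=> _ /(_ i); rewrite in_itv/= ler_norml.
rewrite lee_fin => al1 /(lp_ballP _ al1) h.
have al0 : 0 < alpha by lra.
have : `|tnth x i| `^ alpha <= 1.
  apply: le_trans h; rewrite (bigD1 i)//= lerDl.
  by apply: sumr_ge0 => k _; exact: powR_ge0.
move=> h'; rewrite leNgt; apply/negP => x1.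
have := @gt0_ltr_powR _ _ al0 1 `|tnth x i|.
by rewrite !nnegrE ler01 normr_ge0 powR1 => /(_ isT isT x1); rewrite ltNge h'.
Qed.

Lemma measurable_lp_ball d (alpha : \bar R) : (1 <= alpha)%E ->
  measurable (lp_ball d alpha : set (d.-tuple R)).
Proof.
case: alpha => [alpha| |]// al1.
  rewrite lee_fin in al1.
  pose f (x : d.-tuple R) : R := \sum_(i < d) `|tnth x i| `^ alpha.
  have -> : lp_ball d alpha%:E = setT `&` f @^-1` `]-oo, 1].
    by apply/seteqP; split => x; rewrite setTI /= in_itv/= => /(lp_ballP _ al1).
  suff mf : measurable_fun setT f by apply: mf => //; exact: measurable_itv.
  apply: measurable_sum => i.
  apply: (measurableT_comp (measurable_powR alpha)).
  apply: (measurableT_comp (f := @Num.norm R R)); last exact: measurable_tnth.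
  exact: normr_measurable.
exact: (@measurable_box _ _ (fun=> `[-1, 1]%classic)).
Qed.

Lemma lp_ball_fin d (alpha : \bar R) : (1 <= alpha)%E ->
  (leb_ d (lp_ball d alpha) < +oo)%E.
Proof.
move=> al1; pose A (i : 'I_d) : set R := `[-1, 1]%classic.
have mA i : measurable (A i) by exact: measurable_itv.
apply: (@le_lt_trans _ _ (leb_ d [set x | forall i, A i (tnth x i)])).
  apply: le_measure; rewrite ?inE; [exact: measurable_lp_ball|exact: measurable_box|].
  by move=> x Dx i; rewrite /A/= in_itv/= -ler_norml; exact: lp_ball_le1 Dx.
rewrite (lebesgue_tuple_box mA) (eq_bigr (fun=> 2%:E)) => [|i _].
  by rewrite prodEFin ltry.
rewrite lebesgue_measure_itv/= lte_fin ifT; first by rewrite -EFinB; congr EFin; ring.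
by lra.
Qed.

Lemma lp_ball_box d (alpha : \bar R) (x : d.+1.-tuple R) : (1 <= alpha)%E ->
  (forall i, `|tnth x i| <= d.+1%:R^-1) -> lp_ball d.+1 alpha x.
Proof.
have N1 : 1 <= d.+1%:R :> R by rewrite ler1n.
have NV : 0 < (d.+1%:R : R)^-1 <= 1 by rewrite invr_gt0 invf_le1; lra.
case: alpha => [alpha| |]//; last first.
  by move=> _ h i; rewrite in_itv/= -ler_norml (le_trans (h i))//; case/andP: NV.
rewrite lee_fin => al1 h; apply/lp_ballP => //.
apply: (@le_trans _ _ (\sum_(i < d.+1) d.+1%:R^-1)); last first.
  by rewrite sumr_const card_ord -[_ *+ _]mulr_natl mulfV//; lra.
apply: ler_sum => i _; apply: (@le_trans _ _ (d.+1%:R^-1 `^ alpha)).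
  by apply: ge0_ler_powR; rewrite ?nnegrE//; lra.
exact: ge1r_powR.
Qed.

(** Each coordinate moves inwards: coordinate 0 by x^2, the others by any amount
    between 0 and x^2. *)
Lemma lp_ball_cusps_oo d : has_cusps (lp_ball d.+1 +oo%E : set (d.+1.-tuple R)) 1.
Proof.
exists 1, (1 / 2); split=> [|//|x0 Dx0]; first by lra.
pose sg (y : R) : R := if 0 <= y then -1 else 1.
have sgP (y t : R) : -1 <= y <= 1 -> 0 <= t <= 1 -> -1 <= y + sg y * t <= 1.
  by move=> y1 t1; rewrite /sg; case: (leP 0 y) => y0; lra.
exists ord0, (sg (tnth x0 ord0)), (fun i => sg (tnth x0 (lift ord0 i)) / 2), (fun=> 0).
split; first by rewrite /sg; case: ifP => _; rewrite ?normrN normr1.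
move=> x z x1 hz i; rewrite /= in_itv/=.
have x2 : 0 <= x ^+ 2 <= 1.
  by rewrite sqr_ge0 -real_normK ?num_real//= expr_le1.
have D0 k : -1 <= tnth x0 k <= 1 by have := Dx0 k; rewrite /= in_itv.
have [k|] := unliftP ord0 i => ->; last first.
  rewrite tnth_ins_id big1 ?subr0; last by move=> k _; rewrite mul0r.
  exact: sgP.
rewrite tnth_ins_lift tnth_mktuple.
have : `|z k| <= x ^+ 2 / 2.
  apply: (le_trans (hz k)); rewrite mulr1 powR_mulrn// real_normK ?num_real//; lra.
rewrite ler_norml => zk.
have -> : sg (tnth x0 (lift ord0 k)) / 2 * x ^+ 2 + z k =
  sg (tnth x0 (lift ord0 k)) * (x ^+ 2 / 2 + sg (tnth x0 (lift ord0 k)) * z k).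
  by rewrite /sg; case: ifP => _; field.
by apply: sgP => //; rewrite /sg; case: ifP => _; lra.
Qed.

(** Let j be the largest coordinate of x0. Near the centre the cusp lies in an
    inscribed cube. Otherwise, the cusp is tilted along the tangent hyperplane of the
    level set through x0, so that the linear terms in z cancel in the Taylor
    expansion of sum |x_i|^alpha. The displacement t0 x^2 in coordinate j gains
    a multiple of t0 x^2 because the derivative in that coordinate is bounded
    below. The remainders |z_i|^min(alpha,2) <= lam x^2 are smaller for small
    lam, and so is the quadratic remainder (of order (t0 x)^2) in coordinate j
    for small t0. *)
Lemma lp_ball_cusps d (alpha : R) : 1 <= alpha ->
  has_cusps (lp_ball d.+1 alpha%:E : set (d.+1.-tuple R)) (Num.min alpha 2)^-1.
Proof.
move=> al1; set m := Num.min alpha 2.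
have m12 : 1 <= m <= 2 by rewrite /m; case: (leP alpha 2) => h; lra.
pose kap : R := (2 * d.+1%:R)^-1.
have N1 : 1 <= d.+1%:R :> R by rewrite ler1n.
have kap0 : 0 < kap by rewrite invr_gt0; lra.
have kapN : kap * (2 * d.+1%:R) = 1 by rewrite mulVf//; lra.
have kap1 : kap <= 1 / 2 by nra.
have [C1 C10 H1] := norm_powRD al1.
have [C3 C30 H3] := norm_powRD_away al1 kap0.
pose kp := kap `^ (alpha - 1).
have kp0 : 0 < kp by rewrite powR_gt0.
have kp1 : kp <= 1.
  by apply: powR_le1; lra.
pose t0 := Num.min kap (kp / (8 * C3)).
have t00 : 0 < t0 by rewrite lt_min kap0 divr_gt0//; lra.
have t0k : t0 <= kap by rewrite ge_min lexx.
have t0C : 8 * C3 * t0 <= kp.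
  rewrite mulrC -ler_pdivlMr; last lra.
  by rewrite ge_min lexx orbT.
pose lam := t0 * kp / (2 * d.+1%:R * (C1 + 1)).
have den : 0 < 2 * d.+1%:R * (C1 + 1) by apply: mulr_gt0; lra.
have lam0 : 0 < lam by rewrite divr_gt0// mulr_gt0.
have lamE : lam * (2 * d.+1%:R * (C1 + 1)) = t0 * kp by rewrite divfK// gt_eqF.
pose E : R := d.+1%:R * lam.
have E0 : 0 < E by apply: mulr_gt0 => //; lra.
have EC0 : 0 < E * C1 by exact: mulr_gt0.
have EE : 2 * E + 2 * (E * C1) = t0 * kp by rewrite -lamE /E; ring.
have tk : t0 * kp <= t0 by rewrite ler_piMr// ltW.
have Et0 : E <= t0 by lra.
have lamE1 : lam <= E by rewrite /E ler_peMl// ltW.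
have t0d (y : R) : y <= t0 -> t0 + y <= 2 * t0 by lra.
have dN : d%:R <= d.+1%:R :> R by rewrite ler_nat.
have dlam0 : 0 <= d%:R * lam by rewrite mulr_ge0// ltW.
have dlam : d%:R * lam <= E by rewrite ler_wpM2r// ltW.
have lamt : lam <= t0 by lra.
have lam1 : lam <= 1 by lra.
exists t0, lam; split=> // x0 Dx0.
have Dx1 i : `|tnth x0 i| <= 1 by apply: lp_ball_le1 Dx0.
have pw (x : R) : `|x| <= 1 -> `|x| `^ (2 * m^-1) <= `|x|.
  move=> x1; have [->|x0'] := eqVneq x 0.
    by rewrite normr0 powR0// mulf_neq0 ?invr_neq0// gt_eqF//; lra.
  apply: ge1r_powR; first by rewrite normr_gt0 x0'.
  by rewrite ler_pdivlMr; lra.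
have [j _ jmax] := @Order.TotalTheory.arg_maxP _ _ _ ord0 xpredT
  (fun i => `|tnth x0 i|) isT.
have {}jmax i : `|tnth x0 i| <= `|tnth x0 j| by exact: jmax.
have x2 (x : R) : `|x| <= 1 -> 0 <= x ^+ 2 <= 1.
  by move=> x1; rewrite sqr_ge0 -real_normK ?num_real//= expr_le1.
have z1 (x z : R) : `|x| <= 1 -> `|z| <= lam * `|x| `^ (2 * m^-1) -> `|z| <= lam * `|x|.
  by move=> x1 /le_trans; apply; rewrite ler_wpM2l ?(ltW lam0)// pw.
have [xsmall|xbig] := leP `|tnth x0 j| kap.
  exists j, t0, (fun=> 0), (fun=> 0); split; first by rewrite gtr0_norm.
  move=> x z x1 hz; apply: lp_ball_box => // i.
  have -> : d.+1%:R^-1 = kap + kap :> R.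
    by rewrite /kap invfM; field; rewrite gt_eqF//; lra.
  have [k|] := unliftP j i => ->.
    rewrite tnth_ins_lift tnth_mktuple mul0r add0r (le_trans (ler_normD _ _))//.
    apply: lerD; first exact: le_trans (jmax _) xsmall.
    apply: (le_trans (z1 _ _ x1 (hz k))).
    by apply: (@le_trans _ _ lam); [rewrite ler_piMr// ltW|lra].
  rewrite tnth_ins_id big1 ?subr0; last by move=> k _; rewrite mul0r.
  rewrite (le_trans (ler_normD _ _))// lerD//.
  have /andP[xx0 xx1] := x2 x x1.
  rewrite ger0_norm; last exact: mulr_ge0 (ltW t00) xx0.
  by apply: le_trans t0k; rewrite ler_piMr// ltW.
set A := `|tnth x0 j| in xbig *.
have A0 : 0 < A by lra.
have xj0 : tnth x0 j != 0 by rewrite -normr_gt0.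
pose dj := dpow alpha (tnth x0 j).
have powA (y : R) : 0 < y -> y * y `^ (alpha - 2) = y `^ (alpha - 1).
  move=> y0; rewrite -{1}(powRr1 (ltW y0)) -powRD ?(gt_eqF y0) ?implybT//.
  by congr (_ `^ _); ring.
have norm_dpow (y : R) : `|dpow alpha y| = alpha * (`|y| * `|y| `^ (alpha - 2)).
  by rewrite /dpow !normrM (ger0_norm (powR_ge0 _ _)) (@ger0_norm _ alpha)//; lra.
have djE : dj * - Num.sg (tnth x0 j) = - (alpha * A `^ (alpha - 1)).
  rewrite -powA// /dj /dpow -/A mulrN; congr (- _).
  rewrite -mulrA; congr (_ * _); rewrite mulrAC; congr (_ * _).
  by rewrite /A normrEsg mulrC.
have dj0 : dj != 0 by rewrite -normr_gt0 norm_dpow -/A powA// mulr_gt0 ?powR_gt0//; lra.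
have g1 i : `|dpow alpha (tnth x0 (lift j i)) / dj| <= 1.
  rewrite normf_div ler_pdivrMr ?normr_gt0// mul1r !norm_dpow -/A.
  rewrite ler_wpM2l//; first lra.
  have [->|xi0] := eqVneq (tnth x0 (lift j i)) 0.
    by rewrite normr0 mul0r mulr_ge0 ?powR_ge0// ltW.
  rewrite !powA ?normr_gt0//.
  by apply: ge0_ler_powR; rewrite ?nnegrE// ?(ltW A0)//; lra.
have kA : kp <= alpha * A `^ (alpha - 1).
  apply: (@le_trans _ _ (A `^ (alpha - 1))); last by rewrite ler_peMl// powR_ge0.
  apply: ge0_ler_powR; rewrite ?nnegrE ?subr_ge0 ?(ltW kap0) ?(ltW A0)//.
  exact: ltW.
exists j, (- Num.sg (tnth x0 j) * t0), (fun=> 0),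
  (fun i => dpow alpha (tnth x0 (lift j i)) / dj).
split; first by rewrite normrM normrN normr_sg xj0 mul1r gtr0_norm.
move=> x z x1 hz; apply/lp_ballP => //.
pose h := - Num.sg (tnth x0 j) * t0 * x ^+ 2
  - \sum_i dpow alpha (tnth x0 (lift j i)) / dj * z i.
have hE : tnth x0 j + - Num.sg (tnth x0 j) * t0 * x ^+ 2
    - \sum_i dpow alpha (tnth x0 (lift j i)) / dj * (0 * x ^+ 2 + z i)
    = tnth x0 j + h.
  rewrite -addrA; congr (_ + (_ - _)).
  by apply: eq_bigr => i _; rewrite mul0r add0r.
have X0 : 0 <= `|x| by [].
have hle : `|h| <= (t0 + d%:R * lam) * `|x|.
  rewrite /h mulrDl (le_trans (ler_normB _ _))// lerD//.
    rewrite !normrM normrN normr_sg xj0 mul1r (gtr0_norm t00) ler_wpM2l ?(ltW t00)//.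
    by rewrite ler_piMr.
  rewrite (le_trans (ler_norm_sum _ _ _))//.
  rewrite -mulrA -[X in X%:R * _]card_ord mulr_natl -sumr_const; apply: ler_sum => i _.
  rewrite normrM; apply: (@le_trans _ _ (1 * (lam * `|x|))); last by rewrite mul1r.
  by apply: ler_pM => //; exact: z1.
have h1 : `|h| <= 1.
  apply: (le_trans hle); apply: (@le_trans _ _ (t0 + d%:R * lam)); last by lra.
  by rewrite ler_piMr// addr_ge0// ltW.
have h2 : h ^+ 2 <= (t0 + d%:R * lam) ^+ 2 * x ^+ 2.
  rewrite -(real_normK (num_real h)) -(real_normK (num_real x)) -exprMn.
  by rewrite lerXn2r ?nnegrE// mulr_ge0// addr_ge0// ltW.
have zm i : `|z i| `^ m <= lam * x ^+ 2.
  apply: (@le_trans _ _ ((lam * `|x| `^ (2 * m^-1)) `^ m)).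
    apply: ge0_ler_powR; rewrite ?nnegrE//; first lra.
    by rewrite mulr_ge0 ?powR_ge0// ltW.
  rewrite powRM ?powR_ge0 ?(ltW lam0)// -powRrM divfK; last by rewrite gt_eqF//; lra.
  rewrite powR_mulrn// real_normK ?num_real//.
  rewrite ler_wpM2r ?sqr_ge0//; apply: ge1r_powR; first by rewrite lam0.
  by case/andP: m12.
have zi1 i : `|z i| <= 1.
  by apply: (le_trans (z1 _ _ x1 (hz i))); rewrite mulr_ile1// ltW.
have kapA : kap <= `|tnth x0 j| <= 1 by rewrite -/A (ltW xbig) Dx1.
rewrite (bigD1_ord j)//= tnth_ins_id hE.
apply: (@le_trans _ _ (A `^ alpha + dj * h + C3 * h ^+ 2 + \sum_(i < d)
   (`|tnth x0 (lift j i)| `^ alpha + dpow alpha (tnth x0 (lift j i)) * z i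
     + C1 * (lam * x ^+ 2)))).
  apply: lerD; first exact: H3.
  apply: ler_sum => i _; rewrite tnth_ins_lift tnth_mktuple mul0r add0r.
  by apply: (le_trans (H1 _ _ (Dx1 _) (zi1 i))); rewrite lerD2l ler_wpM2l// ltW.
have sumx : A `^ alpha + \sum_(i < d) `|tnth x0 (lift j i)| `^ alpha <= 1.
  by move/(lp_ballP _ al1): Dx0; rewrite (bigD1_ord j).
rewrite !big_split/= sumr_const card_ord -[_ *+ d]mulr_natl.
have djh : dj * h + \sum_(i < d) dpow alpha (tnth x0 (lift j i)) * z i =
    - (alpha * A `^ (alpha - 1)) * t0 * x ^+ 2.
  rewrite /h mulrBr !mulrA djE mulr_sumr.
  rewrite [X in _ - X](eq_bigr
    (fun i => dpow alpha (tnth x0 (lift j i)) * z i)) ?subrK//.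
  by move=> i _; rewrite mulrCA mulrA; congr (_ * _); rewrite divfK.
have /andP[xx0 _] := x2 x x1.
have f1 : C3 * h ^+ 2 <= kp * t0 / 2 * x ^+ 2.
  apply: (@le_trans _ _ (C3 * ((t0 + d%:R * lam) ^+ 2 * x ^+ 2))).
    by rewrite ler_wpM2l// ltW.
  rewrite mulrA ler_wpM2r//.
  have : (t0 + d%:R * lam) ^+ 2 <= (2 * t0) ^+ 2.
    have q0 : 0 <= t0 + d%:R * lam by rewrite addr_ge0// ltW.
    rewrite lerXn2r ?nnegrE//; first by rewrite mulr_ge0// ltW.
    by apply: t0d; apply: le_trans dlam Et0.
  move=> /(ler_wpM2l (ltW C30)) /le_trans; apply.
  have : (8 * C3 * t0) * t0 <= kp * t0 by rewrite ler_pM2r.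
  by rewrite exprMn; nra.
have f2 : d%:R * (C1 * (lam * x ^+ 2)) <= kp * t0 / 2 * x ^+ 2.
  have -> : d%:R * (C1 * (lam * x ^+ 2)) = d%:R * lam * C1 * x ^+ 2 by ring.
  rewrite ler_wpM2r//; apply: (@le_trans _ _ (E * C1)); last by lra.
  by rewrite ler_wpM2r// ltW.
have f3 : kp * t0 * x ^+ 2 <= alpha * A `^ (alpha - 1) * t0 * x ^+ 2.
  by rewrite ler_wpM2r// ler_wpM2r// ltW.
move: djh f1 f2 f3 sumx; move: (\sum_(i < d) dpow _ _ * _) => S2.
move: (\sum_(i < d) `|_| `^ _) => S1.
rewrite -/dj; lra.
Qed.

End lp_balls.

(** * Contact of the balls with a supporting hyperplane *)

Section contact.
Context {R : realType}.

(** Contact of order 1/gamma between D and a supporting hyperplane at x0. *)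
Definition has_contact d (D : set (d.+1.-tuple R)) (gamma : R) :=
  exists (x0 : d.+1.-tuple R) (v : 'I_d -> R) (C T : R),
    [/\ 0 <= C, 0 < T, D x0 & forall x, D x -> 0 <= depth x0 v x <= T /\
      forall i, `|tnth x (lift ord0 i) - tnth x0 (lift ord0 i)| <=
        C * depth x0 v x `^ gamma].

(** At the vertex (1, 0, ..., 0): |x_i|^alpha <= 1 - |x_0|^alpha, which is at most
    alpha (1 - x_0). *)
Lemma lp_ball_contact_le2 d (alpha : R) : 1 <= alpha <= 2 ->
  has_contact (lp_ball d.+1 alpha%:E) alpha^-1.
Proof.
move=> /andP[al1 al2]; have al0 : 0 < alpha by lra.
pose x0 : d.+1.-tuple R := [tuple (i == ord0)%:R | i < d.+1].
have x00 : tnth x0 ord0 = 1 by rewrite tnth_mktuple.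
have x0S i : tnth x0 (lift ord0 i) = 0 by rewrite tnth_mktuple.
have depthE x : depth x0 (fun=> 0) x = 1 - tnth x ord0.
  by rewrite /depth x00 big1 ?addr0// => i _; rewrite mul0r.
exists x0, (fun=> 0), (2 `^ alpha^-1), 2; split=> //.
  apply/lp_ballP => //; rewrite big_ord_recl x00 normr1 powR1 big1 ?addr0// => i _.
  by rewrite x0S normr0 powR0// gt_eqF.
move=> x Dx.
have := @lp_ball_le1 R _ alpha%:E x ord0; rewrite lee_fin => /(_ al1 Dx).
move=> x01; have := x01; rewrite ler_norml depthE => /andP[x0l x0r].
split=> [|i]; first lra.
rewrite x0S subr0.
have xi : `|tnth x (lift ord0 i)| `^ alpha <= 2 * (1 - tnth x ord0).
  move/(lp_ballP _ al1): Dx; rewrite big_ord_recl (bigD1 i)//= => S1.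
  have S0 : 0 <= \sum_(k < d | k != i) `|tnth x (lift ord0 k)| `^ alpha.
    by apply: sumr_ge0 => k _; exact: powR_ge0.
  have := bernoulli_powR al1 (normr_ge0 (tnth x ord0)).
  have := ler_norm (tnth x ord0); set a := tnth x ord0 in x01 x0l x0r S1 *.
  have : (alpha - 2) * (1 - `|a|) <= 0 by nra.
  lra.
have -> : `|tnth x (lift ord0 i)| = (`|tnth x (lift ord0 i)| `^ alpha) `^ alpha^-1.
  by rewrite -powRrM divff ?powRr1// gt_eqF.
rewrite -powRM//; last lra.
by apply: ge0_ler_powR; rewrite ?nnegrE ?powR_ge0 ?invr_ge0//; lra.
Qed.

Lemma depth_ones d (x0 x : d.+1.-tuple R) :
  depth x0 (fun=> 1) x = \sum_i (tnth x0 i - tnth x i).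
Proof.
rewrite /depth big_ord_recl; congr (_ + _).
by apply: eq_bigr => i _; rewrite mul1r.
Qed.

(** At the point a (1, ..., 1) of the diagonal. Since |.|^alpha is convex in the
    square of the variable, the ball lies in the Euclidean ball through that
    point, and the contact is that of a sphere with its tangent plane. *)
Lemma lp_ball_contact_ge2 d (alpha : R) : 2 <= alpha ->
  has_contact (lp_ball d.+1 alpha%:E) 2^-1.
Proof.
move=> al2; have al0 : 0 < alpha by lra.
have al1 : 1 <= alpha by lra.
have N1 : 1 <= d.+1%:R :> R by rewrite ler1n.
pose a : R := d.+1%:R `^ (- alpha^-1).
have a0 : 0 < a by rewrite powR_gt0//; lra.
have aal : a `^ alpha = d.+1%:R^-1.
  by rewrite /a -powRrM mulNr mulVf ?powR_inv1// gt_eqF.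
pose x0 : d.+1.-tuple R := [tuple a | i < d.+1].
have x0E i : tnth x0 i = a by rewrite tnth_mktuple.
have Dx0 : lp_ball d.+1 alpha%:E x0.
  apply/lp_ballP => //; under eq_bigr do rewrite x0E gtr0_norm// aal.
  by rewrite sumr_const card_ord -[_ *+ _]mulr_natl mulfV//; lra.
have a1 : a <= 1.
  have := @lp_ball_le1 R _ alpha%:E x0 ord0; rewrite lee_fin x0E gtr0_norm//.
  exact.
exists x0, (fun=> 1), (Num.sqrt (2 * a)), (2 * d.+1%:R); split=> //.
move=> x Dx; rewrite depth_ones.
have xi1 i : `|tnth x i| <= 1.
  by have := @lp_ball_le1 R _ alpha%:E x i; rewrite lee_fin; apply.
set t := \sum_i _.
have key : \sum_(i < d.+1) (tnth x i - a) ^+ 2 <= 2 * a * t.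
  have h : \sum_(i < d.+1) (a `^ alpha + alpha / 2 * a `^ (alpha - 2)
      * (tnth x i ^+ 2 - a ^+ 2)) <= 1.
    move/(lp_ballP _ al1): Dx; apply: le_trans; apply: ler_sum => i _.
    have := norm_powR_convex (tnth x i) al2 (lt0r_neq0 a0).
    by rewrite (gtr0_norm a0).
  move: h; rewrite big_split/= sumr_const card_ord aal -[_ *+ d.+1]mulr_natl.
  rewrite mulfV; last by rewrite gt_eqF//; lra.
  rewrite gerDl -mulr_sumr pmulr_rle0; last first.
    by rewrite mulr_gt0 ?powR_gt0//; lra.
  move=> h; suff e : \sum_(i < d.+1) (tnth x i - a) ^+ 2 =
      2 * a * t + \sum_(i < d.+1) (tnth x i ^+ 2 - a ^+ 2) by rewrite e; lra.
  rewrite /t mulr_sumr -big_split/=; apply: eq_bigr => i _.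
  by rewrite x0E; ring.
have sq0 i : 0 <= (tnth x i - a) ^+ 2 by exact: sqr_ge0.
have t0 : 0 <= t.
  have : 0 <= \sum_(i < d.+1) (tnth x i - a) ^+ 2 by exact: sumr_ge0.
  by move=> /le_trans/(_ key); rewrite pmulr_rge0//; lra.
split=> [|i].
  rewrite t0 /t (@le_trans _ _ (\sum_(i < d.+1) 2))//.
    apply: ler_sum => i _; rewrite x0E.
    by have := xi1 i; rewrite ler_norml; lra.
  by rewrite sumr_const card_ord -[_ *+ _]mulr_natr.
rewrite x0E powR12_sqrt// -sqrtrM; last by lra.
rewrite -sqrtr_sqr ler_wsqrtr//; apply: le_trans key.
by rewrite (bigD1 (lift ord0 i))//= lerDl; apply: sumr_ge0.
Qed.

(** At the corner (1, ..., 1). *)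
Lemma lp_ball_contact_oo d : has_contact (lp_ball d.+1 (+oo%E : \bar R)) 1.
Proof.
have N1 : 1 <= d.+1%:R :> R by rewrite ler1n.
pose x0 : d.+1.-tuple R := [tuple 1 | i < d.+1].
have x0E i : tnth x0 i = 1 by rewrite tnth_mktuple.
exists x0, (fun=> 1), 1, (2 * d.+1%:R); split=> //.
  by move=> i; rewrite x0E /= in_itv/= lexx; lra.
move=> x Dx; rewrite depth_ones.
have xi i : 0 <= tnth x0 i - tnth x i <= 2.
  by have := Dx i; rewrite x0E /= in_itv/=; lra.
have t0 : 0 <= \sum_i (tnth x0 i - tnth x i).
  by apply: sumr_ge0 => i _; case/andP: (xi i).
split=> [|i].
  rewrite t0 (@le_trans _ _ (\sum_(i < d.+1) 2))//.
    by apply: ler_sum => i _; case/andP: (xi i).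
  by rewrite sumr_const card_ord -[_ *+ _]mulr_natr.
rewrite powRr1// mul1r distrC ger0_norm; last by case/andP: (xi (lift ord0 i)).
rewrite (bigD1 (lift ord0 i))//= lerDl; apply: sumr_ge0 => k _.
by case/andP: (xi k).
Qed.

(** The ball contains a cube, so a polynomial vanishing on it is zero. *)
Lemma asymp_lp_ball d (alpha : \bar R) (gamma : R) : (1 <= alpha)%E ->
  1 / 2 <= gamma -> sigma_exponent d.+1 alpha = 2 + 2 * gamma * d%:R ->
  has_cusps (lp_ball d.+1 alpha : set (d.+1.-tuple R)) gamma ->
  has_contact (lp_ball d.+1 alpha : set (d.+1.-tuple R)) gamma ->
  asymp_equiv
    (fun n => christoffel_sup n (lp_ball d.+1 alpha : set (d.+1.-tuple R)))
    (fun n => (n%:R `^ sigma_exponent d.+1 alpha)%:E) /\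
  asymp_equiv
    (fun n => nikolskii_sup n (lp_ball d.+1 alpha : set (d.+1.-tuple R)))
    (fun n => (n%:R `^ (sigma_exponent d.+1 alpha / 2))%:E).
Proof.
move=> al1 g2 -> cusps [x0 [v [C [T [C0 T0 Dx0 DC]]]]].
have mD : measurable (lp_ball d.+1 alpha : set (d.+1.-tuple R)).
  exact: measurable_lp_ball.
have Dfin := @lp_ball_fin R d.+1 _ al1.
have DM (x : d.+1.-tuple R) : lp_ball d.+1 alpha x -> forall i, `|tnth x i| <= 1.
  by move=> Dx i; exact: lp_ball_le1 Dx.
have [C1 C10 up] := upper_of_cusps mD Dfin DM g2 cusps.
have g0 : 0 <= gamma by lra.
have [C2 C20 lo] := lower_of_contact mD Dfin DM g0 C0 T0 Dx0 DC.
apply: (@asymp_of_bounds _ _ _ 1 _ (C1 + C2)) => //.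
- move=> p p0; apply: (@mpoly_eq0_box _ _ p d.+1%:R^-1).
    by rewrite invr_gt0 ltr0n.
  by move=> x xi; apply: p0; exact: lp_ball_box.
- by rewrite addr_gt0.
- move=> n p x n0 pn Dx; apply: (le_trans (up n p x n0 pn Dx)).
  rewrite ler_wpM2r ?dotL2_ge0// ler_wpM2r ?powR_ge0// lerDl; exact: ltW.
- move=> n n0; have [p [x [pn Dx px pp]]] := lo n n0.
  exists p, x; split=> //; apply: (le_trans pp).
  by rewrite ler_wpM2r ?powR_ge0// lerDr ltW.
Qed.

End contact.

Theorem theorem8p1 (R : realType) (d : nat) (alpha : \bar R) :
  (2 <= d)%N -> (1 <= alpha)%E ->
  asymp_equiv
    (fun n => christoffel_sup n (lp_ball d alpha))
    (fun n => (n%:R `^ sigma_exponent d alpha)%:E) /\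
  asymp_equiv
    (fun n => nikolskii_sup n (lp_ball d alpha))
    (fun n => (n%:R `^ (sigma_exponent d alpha / 2))%:E).
Proof.
case: d => // d _ al1.
case: alpha al1 => [alpha| |]// al1.
- have al1' : 1 <= alpha by rewrite -lee_fin.
  apply: (@asymp_lp_ball _ _ _ (Num.min alpha 2)^-1) => //.
  + by rewrite div1r lef_pV2 ?posrE// ?ge_min ?lexx ?orbT// lt_min; lra.
  + rewrite /sigma_exponent -(addn1 d) natrD addrK.
    have [al2|al2] := leP alpha 2; first by [].
    by rewrite divff// mul1r; ring.
  + exact: lp_ball_cusps.
  + have [al2|al2] := leP alpha 2.
      by apply: lp_ball_contact_le2; rewrite al1'.
    exact/lp_ball_contact_ge2/ltW.
- apply: (@asymp_lp_ball _ _ _ 1) => //; first by lra.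
  + by rewrite /sigma_exponent -(addn1 d) natrD; ring.
  + exact: lp_ball_cusps_oo.
  + exact: lp_ball_contact_oo.
Qed.
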